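(* Let $H$ be a probability measure supported in $[0,1)$ and assume that $a>0$. Let $X=(X_t)_{t\geq 0}$ and $Y=(Y_t)_{t\geq 0}$ be two Markov processes on $[0,\infty)$ with infinitesimal generator $$L_a(f)(x)=f'(x)+(x+a)\int_0^1 (f(hx)-f(x))\,H(dh),$$ with arbitrary initial laws $\mathcal{L}(X_0)$ and $\mathcal{L}(Y_0)$. Set $\kappa_1=1-\int_0^1 h\,H(dh)$ and $d=\sqrt{\kappa_1}$. Then for every $t$ and $s$ such that $t>s>0$, $$W_1(\mathcal{L}(X_t),\mathcal{L}(Y_t))\leq \frac{2e^{a\kappa_1 s}}{d\tanh(ds)}\,e^{-a\kappa_1 t}.$$
   Context: A process generated by $L_a$ is the piecewise deterministic Markov process on $[0,\infty)$ that increases linearly with slope $1$ between jumps, jumps at rate $x+a$ when at position $x$, and at each jump is multiplied by an independent random factor of law $H$. $\mathcal{L}(Z)$ denotes the law of $Z$, and $W_1(\alpha,\beta)=\inf_\Pi\int_{\mathbb{R}^2}|x-y|\,\Pi(dx,dy)$ (infimum over all laws $\Pi$ on $\mathbb{R}^2$ with marginals $\alpha$ and $\beta$) is the Wasserstein distance of order 1. *)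

(* Defs.v *)
From HB Require Import structures.
From mathcomp Require Import all_boot all_order all_algebra.
From mathcomp Require Import all_classical all_reals all_analysis.

Set Implicit Arguments.
Unset Strict Implicit.
Unset Printing Implicit Defensive.

Import Order.TTheory GRing.Theory Num.Theory.
Import numFieldNormedType.Exports.

Local Open Scope classical_set_scope.
Local Open Scope ring_scope.

Definition tanh (R : realType) (x : R) : R :=
  (expR x - expR (- x)) / (expR x + expR (- x)).

Definition kappa1 (R : realType) (H : probability R R) : R :=
  1 - \int[H]_(h in `[0, 1]) h.

(* Couplings of two laws on R, and the Wasserstein distance of order 1. It is
   extended-real-valued: it is +oo when every coupling has infinite cost. *)
Definition coupling (R : realType) (alpha beta : set R -> \bar R)
    (Pi : probability (R * R)%type R) : Prop :=
  (forall A : set R, measurable A -> Pi (A `*` setT) = alpha A) /\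
  (forall B : set R, measurable B -> Pi (setT `*` B) = beta B).

Definition W1 (R : realType) (alpha beta : set R -> \bar R) : \bar R :=
  ereal_inf [set \int[Pi]_z (`|z.1 - z.2|%:E)%E
            | Pi in [set Pi | coupling alpha beta Pi]]%E.

(* Mutual independence of an arbitrary family: product rule over every finite
   subfamily. *)
Definition mutually_independent d (Omega : measurableType d) (R : realType)
    (P : probability Omega R) (I : choiceType) (V : I -> {RV P >-> R}) : Prop :=
  forall (s : seq I) (A : I -> set R), uniq s ->
    (forall i, measurable (A i)) ->
    P (\bigcap_(i in [set` s]) (V i @^-1` A i)) =
    (\prod_(i <- s) P (V i @^-1` A i))%E.

Definition drivers (A : Type) (x0 : A) (E Q : nat -> A)
    (i : option (nat + nat)%type) : A :=
  match i with
  | None => x0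
  | Some (inl n) => E n
  | Some (inr n) => Q n
  end.

(* A trajectory x on [0, +oo[ with jump times T 1 < T 2 < ..., started at time
   T 0 = 0. The n-th inter-jump interval ends when the hazard accumulated at
   rate x u + a reaches the threshold e n; the position just before the jump,
   x (T n) + (T n.+1 - T n), is then multiplied by q n. *)
Record pdmp_path (R : realType) (a : R) (x : R -> R) (T e q : nat -> R) : Prop :=
  PdmpPath {
    path_nonneg : forall t, 0 <= t -> 0 <= x t;
    path_start : T 0%N = 0;
    path_increasing : forall n, T n < T n.+1;
    path_no_explosion : T n @[n --> \oo] --> +oo;
    path_flow : forall n t, T n <= t < T n.+1 -> x t = x (T n) + (t - T n);
    path_rate : forall n,
      \int[lebesgue_measure]_(u in `[T n, T n.+1]) (x u + a) = e n;
    path_jump : forall n, x (T n.+1) = q n * (x (T n) + (T n.+1 - T n)) }.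

(* The piecewise deterministic Markov process with generator
     L_a f x = f' x + (x + a) * \int (f (h * x) - f x) H(dh).
   "Jumps at rate x + a" means that the hazards E n accumulated between
   successive jumps are i.i.d. exponential variables of parameter 1. They and
   the factors Q n are almost surely determined by the trajectory, so that
   asking for them on Omega itself is no restriction on X. Only the X t with
   0 <= t are relevant. *)
Definition generated_by_L (R : realType) (a : R) (H : probability R R)
    d (Omega : measurableType d) (P : probability Omega R)
    (X : R -> {RV P >-> R}) : Prop :=
  exists (T : nat -> Omega -> R) (E Q : nat -> {RV P >-> R}),
    [/\ forall n (A : set R), measurable A ->
          distribution P (E n) A = exponential_prob 1 A,
        forall n (A : set R), measurable A -> distribution P (Q n) A = H A,
        mutually_independent (drivers (X 0) E Q) &
        {ae P, forall w,
          pdmp_path a (fun t => X t w) (T ^~ w) (fun n => E n w)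
            (fun n => Q n w)}].

(* Main.v *)
(* By duality on the line, it suffices to show E f(X_t) <= E f(Y_t) + C for every
   bounded 1-Lipschitz f; the quantile coupling attains the dual value, a
   potential being the primitive of the sign of F_Y - F_X.
   Let (r, x) |-> Phi(r, x) be a supersolution of the backward equation
   (d/dr + L_a) Phi <= 0 on [0, s]. Along the jump chain (jump time, position),
   stopped at time s, the expectation of Phi does not increase, and Fatou's
   lemma, with the absence of explosion, gives E Phi(s, X_s) <= E Phi(0, X_0).
   This is applied twice.
   (1) An explicit Phi, with Phi(s, x) = x and Phi(0, x) = 1 / (d tanh(d s))
   independently of x, gives E X_s <= 1 / (d tanh(d s)) for every initial law.
   (2) The semigroup P is approximated by Picard iterates of the Duhamel formula
   for the uniformized process. They satisfy the backward equation up to an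
   arbitrarily small error of either sign, and by Gronwall they are
   e^{-a k (t - r)}-Lipschitz at time r. Hence E f(X_t) and E f(Y_t) both differ
   from the value of P_{t - s} f at 0 by at most e^{-a k (t - s)} / (d tanh(d s))
   in the limit. *)
From HB Require Import structures.
Require Import Defs.
From mathcomp Require Import all_boot all_order all_algebra.
From mathcomp Require Import all_classical all_reals all_analysis.
From mathcomp Require Import measurable_realfun ring lra.

Set Implicit Arguments.
Unset Strict Implicit.

Import Order.TTheory GRing.Theory Num.Theory.
Import numFieldNormedType.Exports.

Local Open Scope classical_set_scope.
Local Open Scope ring_scope.

(** * Independence and the jump chain *)

(** The moment bound is a Riccati comparison: with [k] for [kappa1 H], jumps remove
    [k * x * (x + a)] from the drift, so the mean formally satisfies [m' <= 1 - k * m ^+ 2], whose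
    solution issued from infinity is [coth (d r) / d]. This is the origin of the constant and of its
    independence of the initial law. Replacing [x ^+ 2] by its tangent at [coth (d r) / d] makes the
    comparison affine in [x], so that no second moment is involved. The rate [a * k] comes from a
    synchronous coupling: from [x >= y], both points jump with the same factor at rate [y + a], and
    the higher one jumps alone at rate [x - y]. Since [|h x - y| <= x - h y], the growth due to
    lonely jumps is at most the part of the common contraction due to [y], and the part due to [a]
    is left. The obstacle is the unbounded jump rate. Starts above [M] are discarded, and slope 1
    keeps the others below [M + t], so that a clock of constant rate [M + t + a] suffices; the final
    bounds do not involve [M]. Each process is compared with one deterministic value at the cost of
    one first moment, whence the factor 2. *)

Section independence.
Context (R : realType) (d : measure_display) (Omega : measurableType d).
Variables (P : probability Omega R) (I : choiceType) (D : I -> {RV P >-> R}).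

(** The factors [D i] appear separately on the right, so their mutual independence over [J] is
    included (take [B = setT]); an induction can therefore absorb them into [V] one at a time. *)
Definition independent_of_drivers d' (T : measurableType d')
    (V : Omega -> T) (J : set I) : Prop :=
  forall (s : seq I) (A : I -> set R) (B : set T), uniq s ->
    (forall i, i \in s -> J i) -> (forall i, measurable (A i)) ->
    measurable B ->
    P (V @^-1` B `&` \bigcap_(i in [set` s]) (D i @^-1` A i)) =
    (P (V @^-1` B) * \prod_(i <- s) P (D i @^-1` A i))%E.

Lemma finite_measures_eq_on_rectangles d1 d2 (T1 : measurableType d1)
    (T2 : measurableType d2) (m1 m2 : {measure set (T1 * T2) -> \bar R}) :
  (m1 setT < +oo)%E ->
  (forall A B, measurable A -> measurable B -> m1 (A `*` B) = m2 (A `*` B)) ->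
  forall X, measurable X -> m1 X = m2 X.
Proof.
move=> m1oo m12 X mX.
pose C : set (set (T1 * T2)) :=
  [set C | exists A, measurable A /\ exists B, measurable B /\ C = A `*` B].
have CT : C setT by exists setT; split=> //; exists setT; split=> //; rewrite setXTT.
apply: (measure_unique C (fun=> setT)) => //.
- rewrite measurable_prod_measurableType //; congr (<<s _ >>).
  rewrite predeqE; split => [[A mA [B mB <-]]|[A [mA [B [mB ->]]]]].
    by exists A; split => //; exists B.
  by exists A => //; exists B.
- move=> /= _ _ [X1 [mX1 [X2 [mX2 ->]]]] [Y1 [mY1 [Y2 [mY2 ->]]]].
  rewrite -setXI; exists (X1 `&` Y1); split; first exact: measurableI.
  by exists (X2 `&` Y2); split => //; exact: measurableI.
- by rewrite bigcup_const.
- by move=> _ [A [mA [B [mB ->]]]]; exact: m12.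
Qed.

Lemma independent_of_drivers_map d1 d2 (T1 : measurableType d1)
    (T2 : measurableType d2) (V : Omega -> T1) (g : T1 -> T2) (J : set I) :
  measurable_fun setT g -> independent_of_drivers V J ->
  independent_of_drivers (g \o V) J.
Proof.
move=> mg iV s A B us sJ mA mB; rewrite comp_preimage.
by apply: iV => //; rewrite -[X in measurable X]setTI; exact: mg.
Qed.

Lemma measurable_bigcap_drivers (s : seq I) (A : I -> set R) :
  (forall i, measurable (A i)) ->
  measurable (\bigcap_(i in [set` s]) (D i @^-1` A i)).
Proof.
move=> mA; rewrite bigcap_seq; apply: bigsetI_measurable => i _.
exact: measurable_funPTI.
Qed.

Lemma fin_num_prod_drivers (s : seq I) (A : I -> set R) :
  (forall i, measurable (A i)) ->
  (\prod_(i <- s) P (D i @^-1` A i))%E \is a fin_num.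
Proof.
move=> mA; apply: prode_fin_num => i _.
by apply: fin_num_measure; exact: measurable_funPTI.
Qed.

(** With the event [F] of the remaining drivers fixed, both sides are finite measures in [B], so
    rectangles suffice. On a rectangle, the constraint on [D j] is one more factor of the product
    rule for [V], applied to the list [j :: s]. *)
Lemma independent_of_drivers_pair d' (T : measurableType d')
    (V : Omega -> T) (J : set I) (j : I) :
  measurable_fun setT V -> J j -> independent_of_drivers V J ->
  independent_of_drivers (fun w => (V w, D j w)) (J `\ j).
Proof.
move=> mV Jj iV s A B us sJ mA mB.
have mVD : measurable_fun setT (fun w => (V w, D j w)).
  by apply/measurable_fun_pairP; split.
pose F := \bigcap_(i in [set` s]) (D i @^-1` A i).
have mF : measurable F by exact: measurable_bigcap_drivers.
pose c := fine (\prod_(i <- s) P (D i @^-1` A i))%E.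
have c0 : 0 <= c by apply: fine_ge0; apply: prode_ge0 => i _; exact: measure_ge0.
pose cn : {nonneg R} := NngNum c0.
have cE : (\prod_(i <- s) P (D i @^-1` A i))%E = c%:E.
  by rewrite fineK//; exact: fin_num_prod_drivers.
pose VD : {mfun Omega >-> (T * R)%type} :=
  HB.pack (fun w => (V w, D j w)) (isMeasurableFun.Build _ _ _ _ _ mVD).
pose m1 := pushforward (mrestr P mF) VD.
pose m2 := mscale cn (distribution P VD).
have -> : P ((fun w => (V w, D j w)) @^-1` B `&` F) = m1 B by [].
rewrite cE muleC.
suff -> : m1 B = m2 B by [].
apply: finite_measures_eq_on_rectangles => //.
  rewrite /m1 /pushforward/= /mrestr.
  rewrite (le_lt_trans (probability_le1 _ _)) ?ltry//.
  by rewrite preimage_setT setTI.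
move=> A' B' mA' mB'.
have jS : j \notin s by apply/negP => /sJ[_ /=].
pose A2 i := if i == j then B' else A i.
have PE (S : seq I) : j \notin S ->
    \bigcap_(i in [set` j :: S]) (D i @^-1` A2 i) =
    D j @^-1` B' `&` \bigcap_(i in [set` S]) (D i @^-1` A i).
  move=> jS'; rewrite !bigcap_seq big_cons {1}/A2 eqxx; congr (_ `&` _).
  apply: eq_big_seq => i iS; rewrite /A2; case: eqP => // ij.
  by rewrite -ij iS in jS'.
have mA2 i : measurable (A2 i) by rewrite /A2; case: ifP.
have VDE : VD @^-1` (A' `*` B') = V @^-1` A' `&` D j @^-1` B' by [].
rewrite /m1 /pushforward/= /mrestr.
rewrite /m2/= /mscale/= /distribution /pushforward/=.
have -> : (fun w => (V w, D j w)) @^-1` (A' `*` B') `&` F =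
    V @^-1` A' `&` \bigcap_(i in [set` j :: s]) (D i @^-1` A2 i).
  by rewrite PE// setIA.
rewrite iV//; last 2 first.
- by rewrite /= jS.
- by move=> i; rewrite inE => /orP[/eqP ->//|/sJ[]].
rewrite -[X in (c%:E * P X)%E]/(V @^-1` A' `&` D j @^-1` B').
have -> : V @^-1` A' `&` D j @^-1` B' =
    V @^-1` A' `&` \bigcap_(i in [set` [:: j]]) (D i @^-1` A2 i).
  by rewrite bigcap_seq big_seq1 /A2 eqxx.
rewrite iV//; last by move=> i; rewrite inE => /eqP ->.
rewrite big_cons big_seq1 {1 3}/A2 eqxx muleA [RHS]muleC; congr (_ * _)%E.
rewrite -cE; apply: eq_big_seq => i iS; rewrite /A2; case: eqP => // ij.
by rewrite -ij iS in jS.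
Qed.

(** Independence makes the joint law of [(V, D j)] a product, and Tonelli integrates [D j] out with
    [V] frozen. The Markov property of the jump chain is obtained in this form. *)
Lemma integral_independent_driver d' (T : measurableType d')
    (V : Omega -> T) (J : set I) (j : I) (m : probability R R)
    (g : T * R -> \bar R) :
  measurable_fun setT V -> J j -> independent_of_drivers V J ->
  (forall A, measurable A -> distribution P (D j) A = m A) ->
  measurable_fun setT g -> (forall z, 0 <= g z)%E ->
  (\int[P]_w g (V w, D j w) = \int[P]_w \int[m]_y g (V w, y))%E.
Proof.
move=> mV Jj iV Dm mg g0.
pose V' : {mfun Omega >-> T} := HB.pack V (isMeasurableFun.Build _ _ _ _ _ mV).
have mVD : measurable_fun setT (fun w => (V w, D j w)).
  by apply/measurable_fun_pairP; split.
pose VD : {mfun Omega >-> (T * R)%type} :=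
  HB.pack (fun w => (V w, D j w)) (isMeasurableFun.Build _ _ _ _ _ mVD).
transitivity (\int[distribution P VD]_z g z)%E.
  by rewrite ge0_integral_distribution.
transitivity (\int[distribution P V' \x m]_z g z)%E.
  apply: eq_measure_integral => X mX _; apply/esym.
  apply: product_measure_unique => // A B mA mB.
  transitivity (P (V @^-1` A `&` \bigcap_(i in [set` [:: j]]) (D i @^-1` B))).
    by rewrite bigcap_seq big_seq1.
  rewrite (iV _ (fun=> B))//; last by move=> i; rewrite inE => /eqP ->.
  by rewrite big_seq1; congr (_ * _)%E; exact: Dm.
rewrite fubini_tonelli1// ge0_integral_distribution//.
- exact: measurable_fun_fubini_tonelli_F.
- by move=> y; exact: integral_ge0.
Qed.

End independence.

Section calculus.
Context (R : realType).
Notation mu := (@lebesgue_measure R).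

Lemma is_derive1_continuous (f : R -> R) (x df : R) :
  is_derive x 1 f df -> {for x, continuous f}.
Proof.
by move=> [dfx _]; apply: differentiable_continuous; apply/derivable1_diffP.
Qed.

Lemma integral_is_derive (f F : R -> R) (a b : R) : a <= b ->
  {within `[a, b], continuous f} ->
  {in `[a, b], forall x, {for x, continuous F}} ->
  (forall x, a < x < b -> is_derive x 1 F (f x)) ->
  (\int[mu]_(x in `[a, b]) (f x)%:E = (F b - F a)%:E)%E.
Proof.
move=> ab cf cF FF; have [eab|ltab] := eqVneq a b.
  by rewrite eab set_itv1 integral_set1 subrr.
have {ltab}ltab : a < b by rewrite lt_neqAle ltab.
rewrite (@continuous_FTC2 _ f F a b)// ?EFinB//; last first.
  by move=> x; rewrite in_itv/= => /FF xF; rewrite derive1E; case: xF.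
split.
- by move=> x; rewrite in_itv/= => /FF[].
- by apply/cvg_at_right_filter/cF; rewrite in_itv/= lexx.
- by apply/cvg_at_left_filter/cF; rewrite in_itv/= lexx andbT.
Qed.

End calculus.

(** * The chain of jump times and positions, stopped at time [s] *)

Section jump_chain.
Context (R : realType).
Variable (a s : R).
Notation mu := (@lebesgue_measure R).

(** The nonnegative root [w] of [(x + a) * w + w ^+ 2 / 2 = e]: the hazard accumulated along the
    flow from [x] is quadratic in the elapsed time. *)
Definition holding_time (x e : R) : R :=
  Num.sqrt ((x + a) ^+ 2 + 2 * e) - (x + a).

Lemma holding_time_hazard (x w : R) : 0 < x + a -> 0 <= w ->
  holding_time x ((x + a) * w + w ^+ 2 / 2) = w.
Proof.
move=> xa w0; rewrite /holding_time.
have -> : (x + a) ^+ 2 + 2 * ((x + a) * w + w ^+ 2 / 2) = (x + a + w) ^+ 2 by field.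
by rewrite sqrtr_sqr ger0_norm; [ring|rewrite addr_ge0// ltW].
Qed.

Lemma holding_time_ge0 (x e : R) : 0 < x + a -> 0 <= e -> 0 <= holding_time x e.
Proof.
move=> xa e0; rewrite /holding_time subr_ge0.
rewrite -[leLHS](ger0_norm (ltW xa)) -sqrtr_sqr.
by apply: ler_wsqrtr; rewrite lerDl mulr_ge0.
Qed.

(** A state is a pair (time, position). A jump due after [s] is replaced by flowing up to [s]
    without jumping, so that the final state carries the position at time [s] and not the one at the
    last jump. *)
Definition jump_step (p : R * R) (e q : R) : R * R :=
  let w := holding_time p.2 e in
  if p.1 + w <= s then (p.1 + w, q * (p.2 + w)) else (s, p.2 + (s - p.1)).

(* [`|e n|] and [Num.min `|q n| 1] are almost surely [e n] and [q n]; with them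
   the bounds on the chain hold for every outcome. *)
Fixpoint jump_chain (p : R * R) (e q : nat -> R) (n : nat) : R * R :=
  if n is n'.+1 then
    jump_step (jump_chain p e q n') `|e n'| (Num.min `|q n'| 1)
  else p.

Lemma pdmp_hazard (x : R -> R) (T e q : nat -> R) n :
  pdmp_path a x T e q ->
  e n = (x (T n) + a) * (T n.+1 - T n) + (T n.+1 - T n) ^+ 2 / 2.
Proof.
case=> x0 T0 Tinc _ flow rate _; rewrite -(rate n).
pose b := T n; pose c := T n.+1; pose f u := x b + (u - b) + a.
have bc : b < c by exact: Tinc.
pose F u := (x b + a) * (u - b) + (u - b) ^+ 2 / 2.
have dF (u : R) : is_derive u 1 F (f u).
  apply: is_derive_eq; rewrite /f /GRing.scale/=; lra.
have cf : {within `[b, c], continuous f}.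
  apply: derivable_within_continuous => u _.
  by have [] : is_derive u 1 f 1 by apply: is_derive_eq; lra.
have fi : mu.-integrable `[b, c] (EFin \o f).
  by apply: continuous_compact_integrable => //; exact: segment_compact.
have fi' : mu.-integrable `[b, c[ (EFin \o f).
  by apply: integrableS fi => //; exact: subset_itv_co_cc.
have fE : {in `[b, c[%classic, (fun u => x u + a) =1 f}.
  by move=> u; rewrite inE/= in_itv/= => ubc; rewrite /f (flow n).
rewrite -Rintegral_itv_bndo_bndc; last first.
  apply: eq_integrable fi' => // u ubc; rewrite /= fE//.
transitivity (\int[mu]_(u in `[b, c[) f u); first exact: eq_Rintegral.
rewrite Rintegral_itv_bndo_bndc// /Rintegral.
rewrite (integral_is_derive (F := F) (ltW bc))//=; last first.
  by move=> u _; exact: is_derive1_continuous (dF u).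
have -> : F b = 0 by rewrite /F subrr expr0n/= mulr0 mul0r addr0.
by rewrite subr0.
Qed.

(** A positive hazard takes a positive time, so a jump planned from time [s] always falls after
    [s]. *)
Lemma jump_step_frozen (x e q : R) : 0 < x + a -> 0 < e ->
  jump_step (s, x) e q = (s, x).
Proof.
move=> xa e0; rewrite /jump_step/=.
rewrite subrr addr0; case: ifPn => //; rewrite gerDl leNgt => /negP[].
rewrite /holding_time subr_gt0 -[ltLHS](ger0_norm (ltW xa)) -sqrtr_sqr.
rewrite ltr_sqrt ?ltrDl ?mulr_gt0//.
by rewrite ltr_wpDr ?exprn_gt0// ?mulr_ge0// ltW.
Qed.

Lemma pdmp_jump_time_ge0 (x : R -> R) (T e q : nat -> R) n :
  pdmp_path a x T e q -> 0 <= T n.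
Proof.
move=> path; elim: n => [|n IH]; first by rewrite (path_start path).
exact/(le_trans IH)/ltW/(path_increasing path).
Qed.

Lemma pdmp_hazard_gt0 (x : R -> R) (T e q : nat -> R) n :
  0 < a -> pdmp_path a x T e q -> 0 < e n.
Proof.
move=> a0 path; rewrite (pdmp_hazard n path).
have xT := path_nonneg path (pdmp_jump_time_ge0 n path).
have Tinc := path_increasing path n.
rewrite ltr_wpDr ?divr_ge0 ?sqr_ge0// mulr_gt0 ?subr_gt0//.
by rewrite ltr_wpDl.
Qed.

(** Up to [s] the chain visits the actual jump points of the path. Non-explosion puts [s] between
    two consecutive jumps; the chain then flows to [(s, x s)] and stays there. *)
Lemma jump_chain_pdmp (x : R -> R) (T e q : nat -> R) :
  0 < a -> 0 <= s -> pdmp_path a x T e q -> (forall n, 0 <= q n <= 1) ->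
  \forall n \near \oo, jump_chain (0, x 0) e q n = (s, x s).
Proof.
move=> a0 s0 path q01.
have xT n : 0 <= x (T n).
  exact: path_nonneg path _ (pdmp_jump_time_ge0 n path).
have e0 n : 0 < e n by exact: pdmp_hazard_gt0 path.
have qE n : Num.min `|q n| 1 = q n.
  by have /andP[q0 q1] := q01 n; rewrite ger0_norm// min_l.
have holdE n : holding_time (x (T n)) (e n) = T n.+1 - T n.
  rewrite (pdmp_hazard n path) holding_time_hazard ?ltr_wpDl//.
  by rewrite subr_ge0 ltW// (path_increasing path).
have beforeE n : T n <= s -> jump_chain (0, x 0) e q n = (T n, x (T n)).
  elim: n => [_|n IH Tns] /=; first by rewrite (path_start path).
  rewrite IH ?(le_trans _ Tns) ?ltW ?(path_increasing path)//.
  rewrite /jump_step/= gtr0_norm// holdE qE.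
  rewrite (_ : T n + (T n.+1 - T n) = T n.+1); last by ring.
  by rewrite Tns -(path_jump path).
have [N sTN] : exists N, s < T N.
  have /cvgryPgt/(_ s)[N _ sT] := path_no_explosion path.
  by exists N; exact: sT N (leqnn N).
have [N1 /andP[TN1 sTN1]] : exists n, T n <= s < T n.+1.
  elim: N sTN => [|N IH]; first by rewrite (path_start path) ltNge s0.
  by have [TNs sTN|/IH//] := leP (T N) s; exists N; rewrite TNs.
exists N1.+1 => // n /= N1n; rewrite -(subnK N1n); elim: (n - _)%N => [|k IH].
  rewrite add0n/= beforeE// /jump_step/= gtr0_norm// holdE qE.
  rewrite (_ : T N1 + (T N1.+1 - T N1) = T N1.+1); last by ring.
  by rewrite leNgt sTN1/= (path_flow path (n := N1) (t := s)) ?TN1.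
rewrite addSn/= IH jump_step_frozen// ?normr_gt0 ?gt_eqF//.
by rewrite ltr_wpDl// (path_nonneg path).
Qed.

End jump_chain.

Section measurable_jump_step.
Context (R : realType) (d : measure_display) (T : measurableType d).

Lemma measurable_sqrt (f : T -> R) :
  measurable_fun setT f -> measurable_fun setT (fun x => Num.sqrt (f x)).
Proof.
move=> mf; apply: (@measurableT_comp _ _ _ _ _ _ (@Num.sqrt R)) => //.
by apply: continuous_measurable_fun; exact: sqrt_continuous.
Qed.

Lemma measurable_holding_time (a : R) (x e : T -> R) :
  measurable_fun setT x -> measurable_fun setT e ->
  measurable_fun setT (fun w => holding_time a (x w) (e w)).
Proof.
move=> mx me; rewrite /holding_time.
apply: measurable_funB; last exact: measurable_funD.
apply: measurable_sqrt; apply: measurable_funD; last exact: measurable_funM.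
by apply: measurable_funX; exact: measurable_funD.
Qed.

Lemma measurable_jump_step (a s : R) (p : T -> R * R) (e q : T -> R) :
  measurable_fun setT p -> measurable_fun setT e -> measurable_fun setT q ->
  measurable_fun setT (fun w => jump_step a s (p w) (e w) (q w)).
Proof.
move=> mp me mq; rewrite /jump_step/=.
have [mp1 mp2] : measurable_fun setT (fun w => (p w).1) /\
    measurable_fun setT (fun w => (p w).2).
  by split; exact: measurableT_comp.
have mh := measurable_holding_time a mp2 me.
apply: measurable_fun_ifT.
- by apply: measurable_fun_ler => //; exact: measurable_funD.
- apply: measurable_fun_pair; first exact: measurable_funD.
  by apply: measurable_funM => //; exact: measurable_funD.
- apply: measurable_fun_pair => //; apply: measurable_funD => //.
  exact: measurable_funB.
Qed.

End measurable_jump_step.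

(** * Supersolutions along the stopped chain *)

Section supersolution.
Context (R : realType) (d : measure_display) (Omega : measurableType d).
Variables (P : probability Omega R) (H : probability R R) (a s M : R).
Variables (X : R -> {RV P >-> R}) (T : nat -> Omega -> R).
Variables (E Q : nat -> {RV P >-> R}).
Hypothesis a_gt0 : 0 < a.
Hypothesis s_ge0 : 0 <= s.
Hypothesis Hsupp : H `[0, 1[%classic = 1%E.
Hypothesis E_exp : forall n (A : set R), measurable A ->
  distribution P (E n) A = exponential_prob 1 A.
Hypothesis Q_H : forall n (A : set R), measurable A ->
  distribution P (Q n) A = H A.
Hypothesis indep : mutually_independent (drivers (X 0) E Q).
Hypothesis path : {ae P, forall w,
  pdmp_path a (fun t => X t w) (T ^~ w) (fun n => E n w) (fun n => Q n w)}.

Notation D := (drivers (X 0) E Q).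

(* Starting points above [M] are parked at time [s], where the chain stays put, so
   that the positions, hence the jump rates, are bounded by [M + s] up to [a]. *)
Definition truncated_start (x : R) : R * R :=
  if (0 <= x) && (x <= M) then (0, x) else (s, 0).

Definition truncated_chain (n : nat) (w : Omega) : R * R :=
  jump_chain a s (truncated_start (X 0 w)) (E ^~ w) (Q ^~ w) n.

(** [None], the initial value, is excluded for every [n] because the chain starts from it. *)
Definition future (n : nat) : set (option (nat + nat)) :=
  [set i | if i is Some (inl k) then (n <= k)%N
           else if i is Some (inr k) then (n <= k)%N else false].

Lemma measurable_truncated_start : measurable_fun setT truncated_start.
Proof.
apply: measurable_fun_ifT.
- by apply: measurable_and; apply: measurable_fun_ler.
- by apply: measurable_fun_pair.
- exact: measurable_cst.
Qed.

Lemma measurable_truncated_chain n : measurable_fun setT (truncated_chain n).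
Proof.
elim: n => [|n IH].
  exact: (measurableT_comp measurable_truncated_start).
apply: measurable_jump_step => //; first exact: measurableT_comp.
by apply: measurable_minr => //; exact: measurableT_comp.
Qed.

Lemma independent_of_driversS d' (U : measurableType d') (V : Omega -> U) J J' :
  J' `<=` J -> independent_of_drivers D V J -> independent_of_drivers D V J'.
Proof. by move=> JJ iV r A B us /= sJ; apply: iV => // i /sJ/JJ. Qed.

(** Step [n] reads only [E n] and [Q n]; each is absorbed in turn by [independent_of_drivers_pair],
    and the next state is a measurable function of the resulting triple. *)
Lemma truncated_chain_independent n :
  independent_of_drivers D (truncated_chain n) (future n).
Proof.
elim: n => [|n IH].
  apply: (independent_of_drivers_map (g := truncated_start)).
    exact: measurable_truncated_start.
  move=> r A B us sJ mA mB.
  pose A' i := if i is None then B else A i.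
  have Nr : None \notin r by apply/negP => /sJ.
  have eqr i : i \in r -> A' i = A i by case: i => // /(negP Nr).
  have -> : X 0 @^-1` B `&` \bigcap_(i in [set` r]) (D i @^-1` A i) =
      \bigcap_(i in [set` None :: r]) (D i @^-1` A' i).
    rewrite !bigcap_seq big_cons/=; congr (_ `&` _).
    by apply: eq_big_seq => i /eqr ->.
  rewrite indep//=; last 2 first.
  - by apply/andP; split; [exact: Nr|exact: us].
  - by case=> [i|]; rewrite /A'.
  by rewrite big_cons/=; congr (_ * _)%E; apply: eq_big_seq => i /eqr ->.
have mV := measurable_truncated_chain n.
have iE := independent_of_drivers_pair mV (j := Some (inl n)) (leqnn n) IH.
have mVE : measurable_fun setT (fun w => (truncated_chain n w, E n w)).
  exact: measurable_fun_pair.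
have jQ : (future n `\ Some (inl n)) (Some (inr n)) by split=> //=.
have iEQ := independent_of_drivers_pair mVE jQ iE.
pose g (z : (R * R) * R * R) := jump_step a s z.1.1 `|z.1.2| (Num.min `|z.2| 1).
have mg : measurable_fun setT g.
  apply: measurable_jump_step => //.
  - exact: measurableT_comp.
  - by do 2 apply: measurableT_comp => //.
  - by apply: measurable_minr => //; exact: measurableT_comp.
have iV := independent_of_drivers_map mg iEQ.
apply: (independent_of_driversS _ iV).
move=> [[k|k]|] //= nk; split.
- by split=> //=; [exact: ltnW|case=> kn; move: nk; rewrite kn ltnn].
- by [].
- by split=> //=; exact: ltnW.
- by case=> kn; move: nk; rewrite kn ltnn.
Qed.

(** The Markov property of the chain: [Q n] is integrated out with the state and [E n] frozen, then
    [E n] with the state frozen. *)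
Lemma expectation_jump (m : probability R R) (Phi : R * R -> R) n :
  (forall A, measurable A -> m A = exponential_prob 1 A) ->
  measurable_fun setT Phi -> (forall p, 0 <= Phi p) ->
  (\int[P]_w (Phi (truncated_chain n.+1 w))%:E =
   \int[P]_w \int[m]_e \int[H]_q
     (Phi (jump_step a s (truncated_chain n w) `|e| (Num.min `|q| 1)))%:E)%E.
Proof.
move=> mE mPhi Phi0.
have mV := measurable_truncated_chain n.
have iV := @truncated_chain_independent n.
have mVE : measurable_fun setT (fun w => (truncated_chain n w, E n w)).
  exact: measurable_fun_pair.
have iE := independent_of_drivers_pair mV (j := Some (inl n)) (leqnn n) iV.
have jQ : (future n `\ Some (inl n)) (Some (inr n)) by split=> //=.
pose g (z : (R * R) * R * R) : \bar R :=
  (Phi (jump_step a s z.1.1 `|z.1.2| (Num.min `|z.2| 1)))%:E.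
have mg : measurable_fun setT g.
  apply/measurable_EFinP; apply: measurableT_comp => //.
  apply: measurable_jump_step => //.
  - exact: measurableT_comp.
  - by do 2 apply: measurableT_comp => //.
  - by apply: measurable_minr => //; exact: measurableT_comp.
have g0 z : (0 <= g z)%E by rewrite lee_fin.
have step1 := integral_independent_driver mVE jQ iE (@Q_H n) mg g0.
rewrite [LHS]step1.
pose h (z : (R * R) * R) : \bar R := (\int[H]_q g (z, q))%E.
have mh : measurable_fun setT h by exact: measurable_fun_fubini_tonelli_F.
have h0 z : (0 <= h z)%E by exact: integral_ge0.
apply: (integral_independent_driver mV (leqnn n : future n (Some (inl n))) iV _ mh h0).
by move=> A mA; rewrite (@E_exp n A mA) mE.
Qed.

(** The flow has slope 1 and jumps only lower the position, so the excess over [M] is at most the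
    elapsed time. *)
Definition chain_domain (p : R * R) : Prop :=
  0 <= p.1 <= s /\ 0 <= p.2 <= M + p.1.

Lemma jump_step_domain p e q : chain_domain p -> 0 <= e -> 0 <= q <= 1 ->
  chain_domain (jump_step a s p e q).
Proof.
case: p => r x [/=/andP[r0 rs] /andP[x0 xM]] e0 /andP[q0 q1].
have w0 : 0 <= holding_time a x e by rewrite holding_time_ge0// ltr_wpDl.
have xw0 := addr_ge0 x0 w0.
rewrite /jump_step/=; case: ifPn => [rws|_]; split=> /=.
- by rewrite rws (addr_ge0 r0 w0).
- rewrite mulr_ge0//=; apply: (@le_trans _ _ (x + holding_time a x e)); last lra.
  by rewrite ler_piMl.
- by rewrite s_ge0 lexx.
- by rewrite addr_ge0 ?subr_ge0//=; lra.
Qed.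

Hypothesis M_ge0 : 0 <= M.

Lemma truncated_chain_domain n w : chain_domain (truncated_chain n w).
Proof.
elim: n => [|n IH].
  rewrite /truncated_chain/= /truncated_start; case: ifPn => [/andP[x0 xM]|_].
    by split=> /=; rewrite ?lexx ?s_ge0// addr0 x0.
  by split=> /=; rewrite lexx ?s_ge0// addr_ge0.
apply: jump_step_domain => //.
by rewrite le_min normr_ge0 ler01 ge_min lexx orbT.
Qed.

Lemma factors_in_unit : {ae P, forall w n, 0 <= Q n w <= 1}.
Proof.
apply: ae_foralln => n.
pose N := ~` `[0, 1[%classic : set R.
exists (Q n @^-1` N); split.
- by apply: measurable_funPTI => //; exact: measurableC.
- transitivity (H N); first by apply: Q_H; exact: measurableC.
  by rewrite probability_setC// Hsupp subee.
- move=> w /= Qw; apply: contra_notP Qw => /contrapT/=.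
  by rewrite in_itv/= => /andP[-> /ltW].
Qed.

Lemma limn_einf_le (u : (\bar R)^nat) (c : \bar R) :
  (forall n, u n <= c)%E -> (limn_einf u <= c)%E.
Proof.
move=> uc; rewrite limn_einf_lim; apply: lime_le; first exact: is_cvg_einfs.
apply: nearW => n; apply: (le_trans _ (uc n)); apply: ereal_inf_lbound.
by exists n => /=.
Qed.

Lemma supersolution_le (m : probability R R) (Phi : R * R -> R) :
  (forall A, measurable A -> m A = exponential_prob 1 A) ->
  measurable_fun setT Phi -> (forall p, 0 <= Phi p) ->
  (forall p, chain_domain p ->
    (\int[m]_e \int[H]_q
      (Phi (jump_step a s p `|e| (Num.min `|q| 1)))%:E <= (Phi p)%:E)%E) ->
  (\int[P]_w (Phi (s, if (0 <= X 0 w) && (X 0 w <= M) then X s w else 0))%:E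
   <= \int[P]_w (Phi (truncated_start (X 0 w)))%:E)%E.
Proof.
move=> mE mPhi Phi0 super.
have mPV n : measurable_fun setT (fun w => (Phi (truncated_chain n w))%:E).
  apply/measurable_EFinP; apply: measurableT_comp => //.
  exact: measurable_truncated_chain.
have decr n : (\int[P]_w (Phi (truncated_chain n w))%:E <=
    \int[P]_w (Phi (truncated_start (X 0 w)))%:E)%E.
  elim: n => [//|n IH]; apply: le_trans IH.
  rewrite (expectation_jump _ mE)//; apply: ge0_le_integral => //.
  - by move=> w _; apply: integral_ge0 => e _; apply: integral_ge0 => q _; rewrite lee_fin.
  - pose g (z : (R * R) * R * R) : \bar R :=
      (Phi (jump_step a s z.1.1 `|z.1.2| (Num.min `|z.2| 1)))%:E.
    have mg : measurable_fun setT g.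
      apply/measurable_EFinP; apply: measurableT_comp => //.
      apply: measurable_jump_step => //.
      + exact: measurableT_comp.
      + by do 2 apply: measurableT_comp => //.
      + by apply: measurable_minr => //; exact: measurableT_comp.
    have g0 z : (0 <= g z)%E by rewrite lee_fin.
    have mh := @measurable_fun_fubini_tonelli_F _ _ _ _ _ H g mg g0.
    have h0 z : (0 <= \int[H]_q g (z, q))%E by exact: integral_ge0.
    have mk := @measurable_fun_fubini_tonelli_F _ _ _ _ _ m _ mh h0.
    exact: (measurableT_comp mk (measurable_truncated_chain n)).
  - by move=> w _; apply: super; exact: truncated_chain_domain.
pose F w := (Phi (s, if (0 <= X 0 w) && (X 0 w <= M) then X s w else 0))%:E.
pose G n w := (Phi (truncated_chain n w))%:E.
have mF : measurable_fun setT F.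
  apply/measurable_EFinP; apply: measurableT_comp => //.
  apply: measurable_fun_pair => //; apply: measurable_fun_ifT => //.
  by apply: measurable_and; apply: measurable_fun_ler.
(* Almost surely the chain is eventually constant, so the lower limit is the value of [Phi] at time
   [s]; a discarded start rests at [(s, 0)] from the outset. *)
have lim : {ae P, forall w, setT w -> (F w <= limn_einf (G ^~ w))%E}.
  apply: filterS2 path factors_in_unit => w pw Qw _.
  rewrite (cvg_limn_einf_sup (l := F w) _).1//.
  apply: cvg_near_cst; rewrite /F /G /truncated_chain /truncated_start.
  case: ifPn => _.
    by apply: filterS (jump_chain_pdmp a_gt0 s_ge0 pw Qw) => n /= ->.
  have frozen n : jump_chain a s (s, 0) (E ^~ w) (Q ^~ w) n = (s, 0).
    elim: n => [//|n /= ->]; rewrite jump_step_frozen ?add0r//.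
    by rewrite normr_gt0 gt_eqF// (pdmp_hazard_gt0 _ a_gt0 pw).
  by apply: nearW => n; rewrite frozen.
apply: (@le_trans _ _ (\int[P]_w limn_einf (G ^~ w))%E).
  apply: ae_ge0_le_integral => //.
  - by move=> w _; rewrite lee_fin.
  - move=> w _; rewrite limn_einf_lim; apply: lime_ge; first exact: is_cvg_einfs.
    by apply: nearW => n; apply: le_ereal_inf_tmp => _ [k _ <-]; rewrite lee_fin.
  - rewrite /limn_einf; apply: measurableT_comp => //.
    apply: measurable_fun_limn_esup => n; apply: measurableT_comp => //.
    exact: mPV.
have Fatou : (\int[P]_w limn_einf (G ^~ w) <=
    limn_einf (fun n => \int[P]_w G n w))%E.
  by apply: fatou => // n w _; rewrite lee_fin.
by apply: (le_trans Fatou); exact: limn_einf_le.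
Qed.
End supersolution.

(** * Supersolutions of the backward equation *)

Section density.
Context (d : measure_display) (T : measurableType d) (R : realType).
Import HBNNSimple.

(** Indicators, then nonnegative simple functions, then monotone limits. *)
Lemma ge0_integral_density (mu m : {measure set T -> \bar R}) (p : T -> R)
    (f : T -> \bar R) :
  measurable_fun setT p -> (forall x, 0 <= p x) ->
  (forall A, measurable A -> m A = \int[mu]_(x in A) (p x)%:E)%E ->
  measurable_fun setT f -> (forall x, 0 <= f x)%E ->
  (\int[m]_x f x = \int[mu]_x ((p x)%:E * f x))%E.
Proof.
move=> mp p0 mE mf f0.
have mpE : measurable_fun setT (EFin \o p) by exact/measurable_EFinP.
have indicE (A : set T) : measurable A ->
    (\int[m]_x (\1_A x)%:E = \int[mu]_x ((p x)%:E * (\1_A x)%:E))%E.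
  move=> mA; rewrite integral_indic// setIT mE// [LHS]integral_mkcond/=.
  apply: eq_integral => x _; rewrite patchE indicE.
  by case: ifPn => xA; rewrite ?(mem_set xA) ?(negbTE xA) ?mule1 ?mule0.
have nnsfunE (g : {nnsfun T >-> R}) :
    (\int[m]_x (g x)%:E = \int[mu]_x ((p x)%:E * (g x)%:E))%E.
  under [LHS]eq_integral do rewrite fimfunE -fsumEFin//.
  rewrite [LHS]ge0_integral_fsum//; last 2 first.
  - by move=> r; exact/measurable_EFinP/measurableT_comp.
  - by move=> n x _; rewrite EFinM nnfun_muleindic_ge0.
  under [RHS]eq_integral.
    move=> x _; rewrite fimfunE -fsumEFin// ge0_mule_fsumr; last first.
      by move=> r; rewrite EFinM nnfun_muleindic_ge0.
    over.
  rewrite [RHS]ge0_integral_fsum//; last 2 first.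
  - move=> r; apply: emeasurable_funM => //.
    by apply/measurable_EFinP/measurableT_comp.
  - move=> n x _; apply: mule_ge0; first by rewrite lee_fin.
    by rewrite EFinM nnfun_muleindic_ge0.
  apply: eq_fsbigr => r _; have [r0|r0] := ltP r 0.
    rewrite preimage_nnfun0// indic0 integral0_eq ?integral0_eq// => x _;
      by rewrite !mulr0 ?mule0.
  rewrite integralZl_indic_nnsfun//= indicE// -ge0_integralZl//.
  - by apply: eq_integral => x _; rewrite EFinM muleCA.
  - by apply: emeasurable_funM => //; exact/measurable_EFinP/measurable_indic.
  - by move=> x _; rewrite mule_ge0// lee_fin.
pose g := nnsfun_approx measurableT mf.
have cvg_g x : (g n x)%:E @[n --> \oo] --> f x by exact: cvg_nnsfun_approx.
have nd_g k n x : (k <= n)%N -> g k x <= g n x.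
  by move=> kn; exact/lefP/nd_nnsfun_approx.
transitivity (lim (\int[m]_x (g n x)%:E @[n --> \oo])%E).
  rewrite -monotone_convergence//=.
  - by apply: eq_integral => x _; apply/esym/cvg_lim.
  - by move=> n; exact/measurable_EFinP/measurable_funTS.
  - by move=> n x _; rewrite lee_fin.
  - by move=> x _ k n kn; rewrite lee_fin nd_g.
transitivity (lim (\int[mu]_x ((p x)%:E * (g n x)%:E) @[n --> \oo])%E).
  by congr (lim (_ @ \oo)); apply/funext => n; exact: nnsfunE.
rewrite -monotone_convergence//=.
- apply: eq_integral => x _; apply/cvg_lim => //.
  exact: cvgeZl.
- by move=> n; apply: emeasurable_funM => //; exact/measurable_EFinP/measurable_funTS.
- by move=> n x _; rewrite mule_ge0// lee_fin.
- by move=> x _ k n kn; rewrite lee_wpmul2l ?lee_fin// nd_g.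
Qed.

End density.

(** * One holding time, parametrised by its exponential hazard *)

Section hazard_integral.
Context (R : realType).
Notation mu := (@lebesgue_measure R).
Variables (a x w0 : R) (psi dpsi J : R -> R).
Hypotheses (xa : 0 < x + a) (w0_ge0 : 0 <= w0).
Hypotheses (cpsi : continuous psi) (cdpsi : continuous dpsi) (cJ : continuous J).
Hypothesis psi_derive : forall v : R, 0 < v < w0 -> is_derive v 1 psi (dpsi v).
Hypothesis psi_super : forall v, 0 <= v <= w0 ->
  dpsi v <= (x + v + a) * (psi v - J v).

Let E0 := (x + a) * w0 + w0 ^+ 2 / 2.
Let theta := holding_time a x.
Let root e := Num.sqrt ((x + a) ^+ 2 + 2 * e).

Let root_gt0 e : 0 <= e -> 0 < root e.
Proof.
by move=> e0; rewrite sqrtr_gt0 ltr_wpDr ?exprn_gt0// mulr_ge0.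
Qed.

Let continuous_root : continuous root.
Proof.
move=> e; apply: (@continuous_comp _ _ _ (fun e : R => (x + a) ^+ 2 + 2 * e)
  (@Num.sqrt R)).
  apply: (is_derive1_continuous (df := 2)).
  by apply: is_derive_eq; rewrite /GRing.scale/=; lra.
exact: sqrt_continuous.
Qed.

Let continuous_theta : continuous theta.
Proof.
by move=> e; apply: cvgB; [exact: continuous_root|exact: cvg_cst].
Qed.

Let theta0 : theta 0 = 0.
Proof.
by rewrite /theta /holding_time mulr0 addr0 sqrtr_sqr gtr0_norm// subrr.
Qed.

Let thetaE0 : theta E0 = w0.
Proof. exact: holding_time_hazard. Qed.

Lemma holding_time_incr e e' : 0 <= e -> e < e' ->
  holding_time a x e < holding_time a x e'.
Proof.
move=> e0 ee'; rewrite /holding_time ltrD2r ltr_sqrt ?ltrD2l ?ltr_pM2l//.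
by rewrite ltr_wpDr ?exprn_gt0// mulr_ge0// (le_trans e0) ?ltW.
Qed.

Let theta_le e : 0 <= e <= E0 -> 0 <= theta e <= w0.
Proof.
move=> /andP[e0 eE]; rewrite holding_time_ge0//= -thetaE0.
have [->//|neE] := eqVneq e E0.
by rewrite ltW// holding_time_incr// lt_neqAle neE.
Qed.

Let theta_lt e : 0 < e < E0 -> 0 < theta e < w0.
Proof.
move=> /andP[e0 eE]; rewrite -thetaE0 -theta0 !holding_time_incr// ltW//.
Qed.

Let E0_ge0 : 0 <= E0.
Proof. by rewrite addr_ge0 ?divr_ge0 ?sqr_ge0// mulr_ge0// ltW. Qed.

(** Here [psi v] stands for the supersolution after flowing for a time [v], [J v] for its average
    after a jump at that moment, [w0] for the time left. At hazard [e] the jump rate is [root e] and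
    [theta] has derivative [(root e)^-1], so [G] is a primitive of [g]; dividing [psi_super] by the
    rate gives [expR (- e) * J (theta e) <= g e]. *)
Lemma hazard_integral_le :
  (\int[mu]_(e in `[0%R, E0]) (expR (- e) * J (holding_time a x e))%:E
   <= (psi 0 - expR (- E0) * psi w0)%:E)%E.
Proof.
pose g e := expR (- e) * (psi (theta e) - dpsi (theta e) / root e).
pose G e := - (expR (- e) * psi (theta e)).
have cexpN : continuous (fun e : R => expR (- e)).
  move=> e; apply: (@continuous_comp _ _ _ -%R expR); last exact: continuous_expR.
  exact: oppr_continuous.
have cpsit : continuous (psi \o theta).
  by move=> e; apply: continuous_comp; [exact: continuous_theta|exact: cpsi].
have cg : {within `[0, E0], continuous g}.
  apply: continuous_in_subspaceT => e; rewrite inE/= in_itv/= => /andP[e0 _].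
  apply: cvgM; first exact: cexpN.
  apply: cvgB; first exact: cpsit.
  apply: cvgM; last first.
    by apply: cvgV; [rewrite gt_eqF// root_gt0|exact: continuous_root].
  by apply: continuous_comp; [exact: continuous_theta|exact: cdpsi].
have ck : {within `[0, E0], continuous (fun e => expR (- e) * J (theta e))}.
  apply: continuous_subspaceT => e; apply: cvgM; first exact: cexpN.
  by apply: continuous_comp; [exact: continuous_theta|exact: cJ].
have -> : psi 0 - expR (- E0) * psi w0 = G E0 - G 0.
  by rewrite /G thetaE0 theta0 oppr0 expR0 mul1r opprK addrC.
have <- : (\int[mu]_(e in `[0%R, E0]) (g e)%:E = (G E0 - G 0)%:E)%E.
  apply: integral_is_derive => //.
  - by move=> e _; apply: cvgN; apply: cvgM; [exact: cexpN|exact: cpsit].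
  - move=> e e0E; have /andP[e0 eE] := e0E.
    have r0 := root_gt0 (ltW e0).
    have dth : is_derive e 1 theta (root e)^-1.
      have dsq : is_derive ((x + a) ^+ 2 + 2 * e) 1 (@Num.sqrt R) (2 * root e)^-1.
        by apply: is_derive1_sqrt; rewrite -sqrtr_gt0.
      have dlin : is_derive e 1 (fun e : R => (x + a) ^+ 2 + 2 * e) 2.
        by apply: is_derive_eq; rewrite /GRing.scale/=; lra.
      have dcst : is_derive e 1 (fun=> x + a : R) 0 by exact: is_derive_cst.
      have dr := @is_derive1_comp _ _ (fun e : R => (x + a) ^+ 2 + 2 * e) _ _ _ dsq dlin.
      have -> : (root e)^-1 = (2 * root e)^-1 * 2 - 0 by field; rewrite gt_eqF.
      exact: is_deriveB.
    have dpt : is_derive e 1 (psi \o theta) (dpsi (theta e) * (root e)^-1).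
      by apply: is_derive1_comp; exact: psi_derive (theta_lt e0E).
    have dneg : is_derive e 1 (fun e : R => - e) (-1) by apply: is_derive_eq.
    have dexp := @is_derive1_comp _ _ (fun e : R => - e) _ _ _ (is_derive_expR (- e)) dneg.
    have dG := is_deriveN (is_deriveM dexp dpt).
    apply: (is_derive_eq dG); rewrite /g /GRing.scale/=; ring.
apply: le_integral => //=.
- by apply: continuous_compact_integrable => //; exact: segment_compact.
- by apply: continuous_compact_integrable => //; exact: segment_compact.
move=> e; rewrite inE/= in_itv/= => e0E; have /andP[e0 _] := e0E.
rewrite lee_fin /g ler_wpM2l ?expR_ge0// lerBrDr -lerBrDl.
rewrite ler_pdivrMr ?root_gt0// mulrC.
have := psi_super (theta_le e0E).
by rewrite (_ : x + theta e + a = root e)//; rewrite /theta /holding_time /root; lra.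
Qed.

End hazard_integral.

Section one_step.
Context (R : realType).
Notation mu := (@lebesgue_measure R).

Lemma exponential_prob_gt (m : probability R R) (c : R) : 0 <= c ->
  (forall A, measurable A -> m A = exponential_prob 1 A) ->
  m (~` `[0, c]) = (expR (- c))%:E.
Proof.
move=> c0 mE; rewrite probability_setC// mE//.
have [->|cn0] := eqVneq c 0.
  by rewrite set_itv1 /exponential_prob integral_set1 sube0 oppr0 expR0.
rewrite exponential_prob_itv0c ?lt_neqAle 1?eq_sym ?cn0// mulN1r.
by rewrite oppeB ?adde_defN // addeA subee// add0e.
Qed.

(* [lebesgue_measure] lives on [measurableTypeR R], whose display differs from
   the one of [R]; the identity transports [m] between the two. *)
Lemma ge0_integral_exponential (m : probability R R) (f : R -> \bar R) :
  (forall A, measurable A -> m A = exponential_prob 1 A) ->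
  measurable_fun setT f -> (forall x, 0 <= f x)%E ->
  (\int[m]_x f x = \int[mu]_x ((exponential_pdf 1 x)%:E * f x))%E.
Proof.
move=> mE mf f0.
have mid : measurable_fun setT (idfun : R -> measurableTypeR R).
  by move=> _ Y mY; rewrite setTI preimage_id.
pose idm : {mfun R >-> measurableTypeR R} :=
  HB.pack (idfun : R -> measurableTypeR R) (isMeasurableFun.Build _ _ _ _ _ mid).
rewrite -(@ge0_integral_density _ _ _ mu (distribution m idm))//.
- by rewrite ge0_integral_distribution.
- exact: measurable_exponential_pdf.
- by move=> x; exact: exponential_pdf_ge0.
Qed.

(** The hazard is split at [E0], the amount needed to reach [s]. Below it a jump occurs and
    contributes [J]; above it, with probability [expR (- E0)], the chain reaches [s] and contributes
    [psi w0], which is the boundary term of [hazard_integral_le]. [psi], [dpsi] and [J] are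
    continuous on the whole line, while [Phi] has to match them on the time window only. *)
Lemma one_step_le (m H : probability R R) (a s r x : R) (Phi : R * R -> R)
    (psi dpsi J : R -> R) :
  (forall A, measurable A -> m A = exponential_prob 1 A) ->
  measurable_fun setT Phi -> (forall p, 0 <= Phi p) ->
  0 < x + a -> r <= s ->
  continuous psi -> continuous dpsi -> continuous J ->
  (forall v, 0 <= v <= s - r -> psi v = Phi (r + v, x + v)) ->
  (forall v, 0 <= v <= s - r ->
    (\int[H]_q (Phi (r + v, Num.min `|q| 1 * (x + v)))%:E = (J v)%:E)%E) ->
  (forall v : R, 0 < v < s - r -> is_derive v 1 psi (dpsi v)) ->
  (forall v, 0 <= v <= s - r -> dpsi v <= (x + v + a) * (psi v - J v)) ->
  (\int[m]_e \int[H]_q (Phi (jump_step a s (r, x) `|e| (Num.min `|q| 1)))%:E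
   <= (Phi (r, x))%:E)%E.
Proof.
move=> mE mPhi Phi0 xa rs cpsi cdpsi cJ psiE JE psi_derive psi_super.
set w0 := s - r in psiE JE psi_derive psi_super.
have w0_ge0 : 0 <= w0 by rewrite subr_ge0.
pose E0 := (x + a) * w0 + w0 ^+ 2 / 2.
have E0_ge0 : 0 <= E0 by rewrite addr_ge0 ?divr_ge0 ?sqr_ge0// mulr_ge0// ltW.
have thE0 : holding_time a x E0 = w0 by exact: holding_time_hazard.
pose f (e : R) := (\int[H]_q (Phi (jump_step a s (r, x) `|e| (Num.min `|q| 1)))%:E)%E.
have f0 e : (0 <= f e)%E by apply: integral_ge0 => q _; rewrite lee_fin.
have mf : measurable_fun setT f.
  pose g (z : R * R) := (Phi (jump_step a s (r, x) `|z.1| (Num.min `|z.2| 1)))%:E.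
  apply: (@measurable_fun_fubini_tonelli_F _ _ _ _ _ H g).
    apply/measurable_EFinP; apply: measurableT_comp => //.
    apply: measurable_jump_step => //; first exact: measurableT_comp.
    by apply: measurable_minr => //; exact: measurableT_comp.
  by move=> z; rewrite lee_fin.
pose pdf := @exponential_pdf R 1.
have mpdf : measurable_fun setT pdf by exact: measurable_exponential_pdf.
have pdf0 e : 0 <= pdf e by exact: exponential_pdf_ge0.
have mpf : measurable_fun setT (fun e => (pdf e)%:E * f e)%E.
  by apply: emeasurable_funM => //; exact/measurable_EFinP.
have pf0 e : (0 <= (pdf e)%:E * f e)%E by rewrite mule_ge0// lee_fin.
rewrite ge0_integral_exponential//.
have split (g : measurableTypeR R -> \bar R) :
    measurable_fun setT g -> (forall e, 0 <= g e)%E ->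
    (\int[mu]_e g e = \int[mu]_(e in `[0%R, E0]) g e +
      \int[mu]_(e in ~` `[0%R, E0]) g e)%E.
  move=> mg g0; rewrite -ge0_integral_setU ?setUv//.
  - exact: measurableC.
  - exact/disj_setPCl.
rewrite (split (fun e => (pdf e)%:E * f e)%E)//.
have -> : (\int[mu]_(e in `[0%R, E0]) ((pdf e)%:E * f e) =
    \int[mu]_(e in `[0%R, E0]) (expR (- e) * J (holding_time a x e))%:E)%E.
  apply: eq_integral => e; rewrite inE/= in_itv/= => /andP[e0 eE].
  rewrite /pdf exponential_pdfE// mul1r mulN1r EFinM; congr (_ * _)%E.
  have th0 : 0 <= holding_time a x e by exact: holding_time_ge0.
  have thw : holding_time a x e <= w0.
    have [->|neE] := eqVneq e E0; first by rewrite thE0.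
    by rewrite -thE0 ltW// holding_time_incr// lt_neqAle neE.
  rewrite -JE ?th0//; apply: eq_integral => q _; rewrite /jump_step/= ger0_norm//.
  by rewrite -lerBrDl thw.
have -> : (\int[mu]_(e in ~` `[0%R, E0]) ((pdf e)%:E * f e) =
    (expR (- E0) * psi w0)%:E)%E.
  transitivity (\int[mu]_(e in ~` `[0%R, E0]) ((psi w0)%:E * (pdf e)%:E))%E.
    apply: eq_integral => e; rewrite inE/= in_itv/= => /negP.
    rewrite negb_and -!ltNge => /orP[e0|eE].
      by rewrite /pdf lt0_exponential_pdf// mule0 mul0e.
    rewrite muleC; congr (_ * _)%E; rewrite psiE ?w0_ge0 ?lexx//.
    have e0 : 0 < e by exact: le_lt_trans eE.
    transitivity (\int[H]_q (cst (Phi (r + w0, x + w0))%:E) q)%E.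
      apply: eq_integral => q _; rewrite /jump_step/= gtr0_norm//.
      (* A hazard above [E0] outlasts the horizon, so the factor [q] is never applied. *)
      have : w0 < holding_time a x e by rewrite -thE0 holding_time_incr.
      rewrite /w0 ltrBlDl ltNge => /negbTE ->.
      by rewrite (_ : r + w0 = s)// /w0 addrCA subrr addr0.
    rewrite integral_cst// [X in (_ * X)%E](_ : _ = 1%E) ?mule1//.
    exact: probability_setT.
  rewrite (@ge0_integralZl_EFin _ _ _ mu _ _ (EFin \o pdf))//.
  - transitivity ((psi w0)%:E * m (~` `[0%R, E0]))%E.
      by rewrite mE//; exact: measurableC.
    by rewrite exponential_prob_gt// -EFinM mulrC.
  - exact: measurableC.
  - by move=> e _; rewrite lee_fin.
  - exact/measurable_EFinP/measurable_funTS.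
  - by rewrite psiE ?w0_ge0 ?lexx.
have := hazard_integral_le xa w0_ge0 cpsi cdpsi cJ psi_derive psi_super.
rewrite -/E0 => hle; apply: (le_trans (leeD2r _ hle)).
by rewrite -EFinD subrK psiE ?lexx// !addr0.
Qed.

End one_step.

(** * The moment bound *)

Section bounded_integrands.
Context (R : realType) (d : measure_display) (Omega : measurableType d).
Variable P : probability Omega R.

Lemma integral_probability_cst (c : R) : (\int[P]_w c%:E = c%:E)%E.
Proof.
rewrite (integral_cst P measurableT c%:E) [X in (_ * X)%E](_ : _ = 1%E) ?mule1//.
exact: probability_setT.
Qed.

Lemma Rintegral_probability_cst (c : R) : \int[P]_w c = c.
Proof. by rewrite /Rintegral integral_probability_cst. Qed.

Lemma bounded_integrable (g : Omega -> R) (C : R) : measurable_fun setT g ->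
  (forall w, `|g w| <= C) -> P.-integrable setT (EFin \o g).
Proof.
move=> mg gC; apply: measurable_bounded_integrable => //.
  by rewrite (le_lt_trans (probability_le1 _ _)) ?ltry.
exists C; split; first exact: num_real.
by move=> x Cx w _ /=; rewrite (le_trans (gC w)) ?ltW.
Qed.

End bounded_integrands.

Section kappa.
Context (R : realType) (H : probability R R).
Hypothesis Hsupp : H `[0, 1[%classic = 1%E.

Let H_null : H (~` `[0, 1[%classic) = 0%E.
Proof. by rewrite probability_setC// Hsupp subee. Qed.

Let mclip : measurable_fun setT (fun q : R => Num.min `|q| 1).
Proof. by apply: measurable_minr => //; exact: measurableT_comp. Qed.

Lemma integral_clipped_factor :
  (\int[H]_q (Num.min `|q| 1)%:E = (1 - kappa1 H)%:E)%E.
Proof.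
rewrite /kappa1 opprB addrCA subrr addr0 /Rintegral.
have -> : (\int[H]_q (Num.min `|q| 1)%:E = \int[H]_(q in `[0%R, 1%R]) q%:E)%E.
  rewrite (@ge0_negligible_integral _ _ _ H setT (~` `[0, 1[%classic))//.
  - rewrite (@ge0_negligible_integral _ _ _ H `[0, 1]%classic (~` `[0, 1[%classic))//.
    + have -> : `[0, 1]%classic `\` ~` `[0, 1[%classic = setT `\` ~` `[0, 1[%classic :> set R.
        rewrite setTD setCK setDE setCK; apply/setIidPr.
        by apply: subset_itv_co_cc.
      rewrite setTD setCK; apply: eq_integral => q; rewrite inE/= in_itv/= => /andP[q0 q1].
      by rewrite ger0_norm// min_l// ltW.
    + exact: measurableC.
    + by move=> q /=; rewrite in_itv/= lee_fin => /andP[].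
  - exact: measurableC.
  - exact/measurable_EFinP.
symmetry; apply: fineK; rewrite ge0_fin_numE; last first.
  by apply: integral_ge0 => q /=; rewrite in_itv/= lee_fin => /andP[].
apply: (@le_lt_trans _ _ (\int[H]_(q in `[0%R, 1%R]) cst 1%E q)%E).
  apply: ge0_le_integral => //.
  - by move=> q /=; rewrite in_itv/= lee_fin => /andP[].
  - by move=> q /=; rewrite in_itv/= lee_fin => /andP[].
rewrite integral_cst// mul1e (le_lt_trans (probability_le1 _ _)) ?ltry//.
Qed.

(** The integral of [1 - min (|q|, 1)] is [kappa1 H]. The integrand is nonnegative, and positive on
    [[0, 1[], a set of full mass; a zero integral would make this set negligible. *)
Lemma kappa1_gt0 : 0 < kappa1 H.
Proof.
have mf : measurable_fun setT (fun q : R => (1 - Num.min `|q| 1)%:E).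
  by apply/measurable_EFinP; apply: measurable_funB.
have f0 (q : R) : (0 <= (1 - Num.min `|q| 1)%:E)%E.
  by rewrite lee_fin subr_ge0 ge_min lexx orbT.
have iE : (\int[H]_q (1 - Num.min `|q| 1)%:E + (1 - kappa1 H)%:E = 1%:E)%E.
  rewrite -integral_clipped_factor -ge0_integralD//.
  - under eq_integral do rewrite -EFinD subrK.
    by rewrite integral_probability_cst.
  - exact/measurable_EFinP.
have i0 : (0 <= \int[H]_q (1 - Num.min `|q| 1)%:E)%E by exact: integral_ge0.
have kE : (\int[H]_q (1 - Num.min `|q| 1)%:E = (kappa1 H)%:E)%E.
  move: iE i0; case: (\int[H]_q _)%E => [r| |]// [rE] _; congr EFin; lra.
rewrite -lte_fin -kE lt0e i0 andbT; apply/eqP => i00.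
have [N [mN N0 subN]] : ae_eq H setT (fun q : R => (1 - Num.min `|q| 1)%:E) (cst 0%E).
  apply/ae_eq_integral_abs => //.
  by under eq_integral do rewrite gee0_abs//.
suff : (H `[0%R, 1%R[%classic <= H N)%E by rewrite Hsupp N0 lee_fin ler10.
apply: le_measure; rewrite ?inE// => q; rewrite /= in_itv/= => /andP[q0 q1].
apply: subN => /= /(_ I)[]; rewrite ger0_norm// min_l ?ltW//; lra.
Qed.

Lemma integral_affine_clipped_factor (A B : R) : 0 <= A -> 0 <= B ->
  (\int[H]_q (A * Num.min `|q| 1 + B)%:E = (A * (1 - kappa1 H) + B)%:E)%E.
Proof.
move=> A0 B0.
have mc : measurable_fun setT (fun q : R => (Num.min `|q| 1)%:E) by exact/measurable_EFinP.
have c0 (q : R) : (0 <= (Num.min `|q| 1)%:E)%E by rewrite lee_fin le_min normr_ge0 ler01.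
transitivity (A%:E * \int[H]_q (Num.min `|q| 1)%:E + \int[H]_q B%:E)%E; last first.
  by rewrite integral_clipped_factor integral_probability_cst -EFinM -EFinD.
rewrite -ge0_integralZl// -ge0_integralD//.
- by move=> q _; rewrite mule_ge0.
- by apply: emeasurable_funM.
Qed.

End kappa.

Section generated.
Context (R : realType) (H : probability R R) (a : R) (d : measure_display).
Variables (Omega : measurableType d) (P : probability Omega R).
Variable X : R -> {RV P >-> R}.
Hypothesis Hsupp : H `[0, 1[%classic = 1%E.
Hypothesis a_gt0 : 0 < a.
Hypothesis X_gen : generated_by_L a H X.

(** The default [0] is the position at which [truncated_start] parks a discarded start. *)
Definition truncated_position (M s : R) (w : Omega) : R :=
  if (0 <= X 0 w) && (X 0 w <= M) then X s w else 0.

Lemma measurable_truncated_position M s :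
  measurable_fun setT (truncated_position M s).
Proof.
by apply: measurable_fun_ifT => //; apply: measurable_and; apply: measurable_fun_ler.
Qed.

Lemma generated_ge0 t : 0 <= t -> {ae P, forall w, 0 <= X t w}.
Proof.
case: X_gen => T [E [Q [_ _ _ path]]] t0.
by apply: filterS path => w pw; exact: path_nonneg pw _ t0.
Qed.

(** The condition is asked for every [m] with the exponential law, so that the drivers stay hidden;
    it is applied to the law of the first hazard [E 0]. *)
Lemma generated_supersolution (s M : R) (Phi : R * R -> R) :
  0 <= s -> 0 <= M -> measurable_fun setT Phi -> (forall p, 0 <= Phi p) ->
  (forall m : probability R R,
    (forall A, measurable A -> m A = exponential_prob 1 A) ->
    forall p, chain_domain s M p ->
    (\int[m]_e \int[H]_q
      (Phi (jump_step a s p `|e| (Num.min `|q| 1)))%:E <= (Phi p)%:E)%E) ->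
  (\int[P]_w (Phi (s, truncated_position M s w))%:E <=
   \int[P]_w (Phi (truncated_start s M (X 0 w)))%:E)%E.
Proof.
case: X_gen => T [E [Q [E_exp Q_H indep path]]] s0 M0 mPhi Phi0 super.
apply: (supersolution_le a_gt0 s0 Hsupp E_exp Q_H indep path M0 (E_exp 0%N) mPhi Phi0).
by apply: super; exact: E_exp.
Qed.

End generated.

Section moment.
Context (R : realType).

Definition sinh (x : R) := (expR x - expR (- x)) / 2.
Definition cosh (x : R) := (expR x + expR (- x)) / 2.

Lemma tanhE x : tanh x = sinh x / cosh x.
Proof.
rewrite /tanh /sinh /cosh; have ? : 0 < expR x + expR (- x).
  by rewrite addr_gt0 ?expR_gt0.
by field; rewrite gt_eqF.
Qed.

Lemma is_derive_expRN (x : R) :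
  is_derive x 1 (fun y : R => expR (- y)) (- expR (- x)).
Proof.
have dN : is_derive x 1 (fun y : R => - y) (-1) by apply: is_derive_eq.
apply: (is_derive_eq
  (@is_derive1_comp _ _ (fun y : R => - y) _ _ _ (is_derive_expR (- x)) dN)).
by rewrite mulrN1.
Qed.

Lemma is_derive_sinh (x : R) : is_derive x 1 sinh (cosh x).
Proof.
have d1 := is_deriveB (is_derive_expR x) (is_derive_expRN x).
apply: (is_derive_eq (is_deriveM d1 (is_derive_cst (2^-1 : R) x 1))).
by rewrite /cosh /GRing.scale/=; field.
Qed.

Lemma is_derive_cosh (x : R) : is_derive x 1 cosh (sinh x).
Proof.
have d1 := is_deriveD (is_derive_expR x) (is_derive_expRN x).
apply: (is_derive_eq (is_deriveM d1 (is_derive_cst (2^-1 : R) x 1))).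
by rewrite /sinh /GRing.scale/=; field.
Qed.

Lemma sinh_gt0 x : 0 < x -> 0 < sinh x.
Proof.
move=> x0; rewrite divr_gt0// subr_gt0 ltr_expR; lra.
Qed.

Lemma cosh_gt0 x : 0 < cosh x.
Proof. by rewrite divr_gt0// addr_gt0 ?expR_gt0. Qed.

(** Each side is half of [sinh] at the doubled argument. *)
Lemma sinh_cosh_le x y : x <= y -> sinh x * cosh x <= sinh y * cosh y.
Proof.
move=> xy; have E z : sinh z * cosh z = (expR (2 * z) - expR (- (2 * z))) / 4.
  have -> : 2 * z = z + z by ring.
  rewrite /sinh /cosh opprD !expRD !expRN; field; exact: lt0r_neq0 (expR_gt0 z).
rewrite !E ler_pM2r ?invr_gt0//; apply: lerB; rewrite ler_expR; lra.
Qed.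

End moment.

Section moment_bound.
Context (R : realType) (H : probability R R) (a : R) (d : measure_display).
Variables (Omega : measurableType d) (P : probability Omega R).
Variable X : R -> {RV P >-> R}.
Hypothesis Hsupp : H `[0, 1[%classic = 1%E.
Hypothesis a_gt0 : 0 < a.
Hypothesis X_gen : generated_by_L a H X.
Variable s : R.
Hypothesis s_gt0 : 0 < s.

Let k := kappa1 H.
Let c := Num.sqrt k.
Let k_gt0 : 0 < k. Proof. exact: kappa1_gt0. Qed.
Let c_gt0 : 0 < c. Proof. by rewrite sqrtr_gt0. Qed.
Let cc : c ^+ 2 = k. Proof. by rewrite sqr_sqrtr// ltW. Qed.
Let sh r := @sinh R (c * r).
Let ch r := @cosh R (c * r).
Let S := sh s ^+ 2.

(* Its image by d/dr + L_a is
   - ((c x sh r - ch r)^2 + a x (c sh r)^2) / S <= 0. It equals [x] at [r = s],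
   and at [r = 0] it is [ch s / (c sh s)], whatever [x]. *)
Definition moment_supersolution (r x : R) : R :=
  (sh r ^+ 2 * x + (sh s * ch s - sh r * ch r) / c) / S.

Let sh_s : 0 < sh s. Proof. by rewrite sinh_gt0// mulr_gt0. Qed.
Let S_gt0 : 0 < S. Proof. by rewrite exprn_gt0. Qed.

Let dsh (r : R) : is_derive r 1 sh (c * ch r).
Proof.
have dl : is_derive r 1 (fun r : R => c * r) c.
  by apply: is_derive_eq; rewrite /GRing.scale/= mulr1.
apply: (is_derive_eq
  (@is_derive1_comp _ _ (fun r : R => c * r) _ _ _ (is_derive_sinh _) dl)).
by rewrite mulrC.
Qed.

Let dch (r : R) : is_derive r 1 ch (c * sh r).
Proof.
have dl : is_derive r 1 (fun r : R => c * r) c.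
  by apply: is_derive_eq; rewrite /GRing.scale/= mulr1.
apply: (is_derive_eq
  (@is_derive1_comp _ _ (fun r : R => c * r) _ _ _ (is_derive_cosh _) dl)).
by rewrite mulrC.
Qed.

Let csh : continuous sh.
Proof. by move=> r; apply: is_derive1_continuous (dsh r). Qed.

Let cch : continuous ch.
Proof. by move=> r; apply: is_derive1_continuous (dch r). Qed.

Lemma moment_supersolution_ge0 r x : 0 <= r <= s -> 0 <= x ->
  0 <= moment_supersolution r x.
Proof.
move=> /andP[r0 rs] x0.
apply: divr_ge0; last exact: ltW.
apply: addr_ge0; first by rewrite mulr_ge0 ?sqr_ge0.
apply: divr_ge0; last exact: ltW.
by rewrite subr_ge0 sinh_cosh_le// ler_pM2l.
Qed.

(** The general argument asks for nonnegativity everywhere; the maximum is inactive for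
    [0 <= r <= s] and [0 <= x]. *)
Let Phi (p : R * R) := Num.max 0 (moment_supersolution p.1 p.2).

Let mPhi : measurable_fun setT Phi.
Proof.
have msh : measurable_fun setT (fun p : R * R => sh p.1).
  by apply: measurableT_comp => //; exact: continuous_measurable_fun.
have mch : measurable_fun setT (fun p : R * R => ch p.1).
  by apply: measurableT_comp => //; exact: continuous_measurable_fun.
apply: measurable_maxr => //; apply: measurable_funM => //.
apply: measurable_funD.
  by apply: measurable_funM => //; exact: measurable_funX.
apply: measurable_funM => //; apply: measurable_funB => //.
exact: measurable_funM.
Qed.

Lemma moment_one_step (m : probability R R) (M : R) p :
  (forall A, measurable A -> m A = exponential_prob 1 A) ->
  chain_domain s M p ->
  (\int[m]_e \int[H]_q
    (Phi (jump_step a s p `|e| (Num.min `|q| 1)))%:E <= (Phi p)%:E)%E.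
Proof.
case: p => r x mE [/= /andP[r0 rs] /andP[x0 _]].
pose psi v := moment_supersolution (r + v) (x + v).
pose dpsi v := (2 * c * sh (r + v) * ch (r + v) * (x + v) - ch (r + v) ^+ 2) / S.
pose J v := (sh (r + v) ^+ 2 * (1 - k) * (x + v) +
  (sh s * ch s - sh (r + v) * ch (r + v)) / c) / S.
have c0 : c != 0 by rewrite gt_eqF.
have S0 : S != 0 by rewrite gt_eqF.
have dadd (y v : R) : is_derive v 1 (fun v : R => y + v) 1.
  apply: (is_derive_eq (is_deriveD (is_derive_cst y v 1) (is_derive_id v 1))).
  by rewrite add0r.
have dshr (v : R) : is_derive v 1 (fun v => sh (r + v)) (c * ch (r + v)).
  apply: (is_derive_eq
    (@is_derive1_comp _ _ (fun v : R => r + v) _ _ _ (dsh _) (dadd r v))).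
  by rewrite mulr1.
have dchr (v : R) : is_derive v 1 (fun v => ch (r + v)) (c * sh (r + v)).
  apply: (is_derive_eq
    (@is_derive1_comp _ _ (fun v : R => r + v) _ _ _ (dch _) (dadd r v))).
  by rewrite mulr1.
have dpsiE (v : R) : is_derive v 1 psi (dpsi v).
  have d3 := is_deriveM (is_deriveM (dshr v) (dshr v)) (dadd x v).
  have d4 := is_deriveB (is_derive_cst (sh s * ch s : R) v 1)
    (is_deriveM (dshr v) (dchr v)).
  have d5 := is_deriveD d3 (is_deriveM d4 (is_derive_cst (c^-1 : R) v 1)).
  have d6 := is_deriveM d5 (is_derive_cst (S^-1 : R) v 1).
  apply: (is_derive_eq d6).
  by rewrite /dpsi /GRing.scale/= !fctE; field; rewrite S0 c0.
have cshr : continuous (fun v => sh (r + v)).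
  by move=> v; apply: is_derive1_continuous (dshr v).
have cchr : continuous (fun v => ch (r + v)).
  by move=> v; apply: is_derive1_continuous (dchr v).
have cx : continuous (fun v : R => x + v).
  by move=> v; apply: is_derive1_continuous (dadd x v).
have csc v : {for v, continuous (fun v => sh (r + v) * ch (r + v))}.
  by apply: cvgM; [exact: cshr|exact: cchr].
have v_dom v : 0 <= v <= s - r -> 0 <= r + v <= s /\ 0 <= x + v.
  by move=> /andP[v0 vs]; split; [lra|rewrite addr_ge0].
have sc_le v : 0 <= v <= s - r ->
    0 <= (sh s * ch s - sh (r + v) * ch (r + v)) / c.
  move=> /v_dom[/andP[_ rvs] _]; rewrite divr_ge0 ?(ltW c_gt0)// subr_ge0.
  by rewrite sinh_cosh_le// ler_pM2l.
apply: (@one_step_le _ m H a s r x Phi psi dpsi J) => //.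
- by move=> p; rewrite le_max lexx.
- by rewrite ltr_wpDl.
- by move=> v; apply: is_derive1_continuous (dpsiE v).
- move=> v; apply: cvgM; last exact: cvg_cst.
  apply: cvgB; last by apply: cvgM; exact: cchr.
  apply: cvgM; last exact: cx.
  apply: cvgM; last exact: cchr.
  by apply: cvgM; [exact: cvg_cst|exact: cshr].
- move=> v; apply: cvgM; last exact: cvg_cst.
  apply: cvgD.
    apply: cvgM; last exact: cx.
    by apply: cvgM; last exact: cvg_cst; apply: cvgM; exact: cshr.
  by apply: cvgM; last exact: cvg_cst; apply: cvgB; [exact: cvg_cst|exact: csc].
- move=> v /v_dom[rv xv]; rewrite /Phi/= max_r//.
  exact: moment_supersolution_ge0.
- move=> v v0; have [rv xv] := v_dom v v0.
  (* In the relevant range [Phi] is affine in the position, so the average sees only the mean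
     [1 - k] of the factor. *)
  transitivity (\int[H]_q (sh (r + v) ^+ 2 * (x + v) / S * Num.min `|q| 1 +
      (sh s * ch s - sh (r + v) * ch (r + v)) / c / S)%:E)%E.
    apply: eq_integral => q _; rewrite /Phi/= max_r; last first.
      by rewrite moment_supersolution_ge0// mulr_ge0// le_min normr_ge0 ler01.
    by congr EFin; rewrite /moment_supersolution; field; rewrite S0 c0.
  rewrite integral_affine_clipped_factor//.
  - by congr EFin; rewrite -/k /J; field; rewrite S0 c0.
  - by apply: divr_ge0; [rewrite mulr_ge0 ?sqr_ge0|exact: ltW].
  - by apply: divr_ge0; [exact: sc_le|exact: ltW].
- move=> v /v_dom[_ xv].
  have -> : (x + v + a) * (psi v - J v) =
      ((x + v + a) * (x + v) * k * sh (r + v) ^+ 2) / S.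
    by rewrite /psi /J /moment_supersolution; field; rewrite S0 c0.
  rewrite /dpsi ler_pM2r ?invr_gt0// -cc.
  have : 0 <= (c * (x + v) * sh (r + v) - ch (r + v)) ^+ 2 by exact: sqr_ge0.
  have : 0 <= a * (x + v) * (c * sh (r + v)) ^+ 2.
    by apply: mulr_ge0; [rewrite mulr_ge0// ltW|exact: sqr_ge0].
  lra.
Qed.

(** For a retained start, [sh 0 = 0] cancels the initial position, and a parked start contributes
    [0]; the bound is thus the same for every [M]. Fatou lets [M] tend to infinity without any
    moment of [X 0]. *)
Lemma moment_bound :
  (\int[P]_w `|X s w|%:E <= ((c * tanh (c * s))^-1)%:E)%E.
Proof.
have Phi0 p : 0 <= Phi p by rewrite le_max lexx.
have bound_ge0 : 0 <= (c * tanh (c * s))^-1.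
  by rewrite invr_ge0 mulr_ge0 ?ltW// tanhE divr_gt0 ?cosh_gt0.
have truncated (M : R) : 0 <= M ->
    (\int[P]_w (Num.max 0 (truncated_position X M s w))%:E <=
      ((c * tanh (c * s))^-1)%:E)%E.
  move=> M0.
  have -> : (\int[P]_w (Num.max 0 (truncated_position X M s w))%:E =
      \int[P]_w (Phi (s, truncated_position X M s w))%:E)%E.
    apply: eq_integral => w _; congr EFin; congr Num.max.
    rewrite /moment_supersolution/= subrr mul0r addr0 mulrC mulrA mulVf ?mul1r//.
    by rewrite gt_eqF.
  apply: (le_trans (generated_supersolution Hsupp a_gt0 X_gen (ltW s_gt0) M0 mPhi Phi0 _)).
    by move=> m mE p; exact: moment_one_step.
  rewrite -[leRHS](integral_probability_cst P); apply: ge0_le_integral => //.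
  - by move=> w _; rewrite lee_fin.
  - apply/measurable_EFinP; apply: measurableT_comp => //.
    by apply: measurableT_comp => //; exact: measurable_truncated_start.
  - move=> w _; rewrite lee_fin /Phi ge_max bound_ge0/= /truncated_start.
    case: ifP => _; last first.
      by rewrite /moment_supersolution/= mulr0 subrr mul0r addr0 mul0r.
    rewrite /moment_supersolution/= /sh mulr0 /sinh oppr0 subrr mul0r expr0n/= !mul0r.
    rewrite add0r subr0 -/(@sinh R (c * s)) -/(sh s) tanhE -/(sh s) -/(ch s) /S.
    rewrite le_eqVlt; apply/orP; left; apply/eqP; field.
    by rewrite !gt_eqF//= cosh_gt0.
pose f n w := (Num.max 0 (truncated_position X n%:R s w))%:E.
have mf n : measurable_fun setT (f n).
  apply/measurable_EFinP; apply: measurable_maxr => //.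
  exact: measurable_truncated_position.
have f0 n w : setT w -> (0 <= f n w)%E by move=> _; rewrite lee_fin le_max lexx.
apply: (@le_trans _ _ (\int[P]_w limn_einf (f ^~ w))%E); last first.
  apply: (le_trans (fatou P measurableT mf f0)).
  by apply: limn_einf_le => n; exact: truncated.
apply: ae_ge0_le_integral => //.
- by apply/measurable_EFinP; exact: measurableT_comp.
- move=> w _; rewrite limn_einf_lim; apply: lime_ge; first exact: is_cvg_einfs.
  by apply: nearW => n; apply: le_ereal_inf_tmp => _ [m _ <-]; exact: f0.
- rewrite /limn_einf; apply: measurableT_comp => //.
  by apply: measurable_fun_limn_esup => n; exact: measurableT_comp.
apply: filterS2 (generated_ge0 X_gen (lexx 0)) (generated_ge0 X_gen (ltW s_gt0)).
move=> w X0 Xs _.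
rewrite (cvg_limn_einf_sup (l := `|X s w|%:E) _).1//.
apply: cvg_near_cst; near=> n; rewrite /f /truncated_position X0/=.
rewrite ifT; last by near: n; exact: nbhs_infty_ger.
by rewrite ger0_norm// max_r.
Unshelve. all: by end_near. Qed.

End moment_bound.

(** * Duality on the half-line *)

Section quantile.
Context (R : realType) (d : measure_display) (Omega : measurableType d).
Variables (P : probability Omega R) (X : {RV P >-> R}).
Hypothesis X_ge0 : {ae P, forall w, 0 <= X w}.

Let cdf_fin x : cdf X x \is a fin_num.
Proof. exact: fin_num_measure. Qed.

Definition real_cdf (x : R) : R := fine (cdf X x).

Lemma real_cdfE x : (real_cdf x)%:E = distribution P X `]-oo, x].
Proof. by rewrite fineK. Qed.

Lemma real_cdf_nd x y : x <= y -> real_cdf x <= real_cdf y.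
Proof. by move=> xy; apply: fine_le => //; exact: cdf_nondecreasing. Qed.

Lemma real_cdf_ge0 x : 0 <= real_cdf x.
Proof. by apply: fine_ge0; exact: cdf_ge0. Qed.

Lemma real_cdf_le1 x : real_cdf x <= 1.
Proof. by rewrite -lee_fin fineK//; exact: cdf_le1. Qed.

Lemma real_cdf_lt0 x : x < 0 -> real_cdf x = 0.
Proof.
move=> x0; apply/eqP; rewrite -eqe real_cdfE; apply/eqP.
have mA : measurable (X @^-1` `]-oo, x]) by exact: measurable_funPTI.
transitivity (P (X @^-1` `]-oo, x])) => //.
apply: (measure_negligible mA); apply: negligibleS X_ge0 => w /=; rewrite in_itv/= => Xx X0.
by move: (le_lt_trans Xx x0); rewrite ltNge X0.
Qed.

Lemma measurable_real_cdf : measurable_fun setT real_cdf.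
Proof.
by apply: nondecreasing_measurable => // x y; exact: real_cdf_nd.
Qed.

(** Outside []0, 1[] the set may be empty or unbounded below; the default [0] keeps the function
    nonnegative. *)
Definition quantile (u : R) : R :=
  if (0 < u) && (u < 1) then inf [set x | u <= real_cdf x] else 0.

(** A Galois connection between the quantile function and the cdf. Right continuity of the cdf makes
    the infimum attained, which gives the direct implication. *)
Lemma quantile_le u x : 0 < u < 1 -> (quantile u <= x) = (u <= real_cdf x).
Proof.
move=> u01; rewrite /quantile u01; have /andP[u0 u1] := u01.
pose S := [set x | u <= real_cdf x].
have S_lb : has_lbound S.
  exists 0 => y; rewrite /S/= => uy; rewrite leNgt; apply/negP => /real_cdf_lt0 y0.
  by move: uy; rewrite y0 leNgt u0.
have S_ne : S !=set0.
  have cvgF : real_cdf y @[y --> +oo] --> (1 : R) by apply: fine_cvg; exact: cvg_cdfy1.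
  have : \forall y \near +oo, u < real_cdf y by exact: cvgr_gt cvgF _ u1.
  by move=> /(@filter_ex _ _ _)[y uy]; exists y; exact: ltW.
apply/idP/idP => [qx|ux]; [|exact: ge_inf].
rewrite leNgt; apply/negP => xu.
have cvgF : real_cdf y @[y --> x^'+] --> real_cdf x.
  by apply: fine_cvg; rewrite fineK//; exact: cdf_right_continuous.
have near1 : \forall y \near x^'+, real_cdf y < u by exact: cvgr_lt cvgF _ xu.
have near2 : \forall y \near x^'+, x < y by exact: nbhs_right_gt.
have near12 : \forall y \near x^'+, real_cdf y < u /\ x < y.
  exact: filterI near1 near2.
have [y [yu xy]] := @filter_ex _ _ (at_right_proper_filter x) _ near12.
have [z Sz zy] := inf_lt S_ne (le_lt_trans qx xy).
by move: (le_lt_trans (le_trans Sz (real_cdf_nd (ltW zy))) yu); rewrite ltxx.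
Qed.

Lemma quantile_ge0 u : 0 <= quantile u.
Proof.
have [u01|u01] := boolP (0 < u < 1); last by rewrite /quantile (negbTE u01).
rewrite leNgt; apply/negP => /real_cdf_lt0 Fq.
by have := quantile_le (quantile u) u01; rewrite lexx Fq leNgt; case/andP: u01 => ->.
Qed.

Lemma preimage_quantile x : quantile @^-1` `]x, +oo[ =
  if x < 0 then setT else `]real_cdf x, 1[%classic.
Proof.
have [x0|x0] := ltP x 0.
  apply/seteqP; split => // u _; rewrite /= in_itv/= andbT.
  exact: lt_le_trans (quantile_ge0 u).
apply/seteqP; split => u; rewrite /= !in_itv/= andbT.
  move=> xq; have [u01|u01] := boolP (0 < u < 1).
    by rewrite ltNge -quantile_le// -ltNge xq; case/andP: u01.
  by move: xq; rewrite /quantile (negbTE u01) ltNge x0.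
move=> /andP[Fu u1]; rewrite ltNge quantile_le -?ltNge//.
by rewrite u1 (le_lt_trans (real_cdf_ge0 x)).
Qed.

Lemma measurable_quantile :
  measurable_fun setT (quantile : measurableTypeR R -> R).
Proof.
apply: (measurability _ (RGenOInfty.measurableE R)) => //.
move=> /= _ [_ [x ->] <-]; rewrite setTI preimage_quantile.
by case: ifP.
Qed.

Let U := uniform_prob (@ltr01 R).

(** The half-lines []x, +oo[] generate the Borel sets and are stable under intersection; for
    [0 <= x] the preimage of such a half-line is an interval of length [1 - real_cdf x]. *)
Lemma distribution_quantile (A : set R) : measurable A ->
  U (quantile @^-1` A) = distribution P X A.
Proof.
move=> mA.
pose q : {mfun measurableTypeR R >-> R} :=
  HB.pack (quantile : measurableTypeR R -> R)
    (isMeasurableFun.Build _ _ _ _ _ measurable_quantile).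
rewrite -[LHS]/(distribution U q A).
have mG : @measurable _ R = <<s @RGenOInfty.G R >> by exact: RGenOInfty.measurableE.
apply: (@measure_unique _ R R (@RGenOInfty.G R) (fun n => `](- n%:R), +oo[%classic)
  mG _ _ _ (distribution U q) (distribution P X)) => //.
- move=> _ _ [x ->] [y ->]; exists (Num.max x y).
  apply/seteqP; split => z /=; rewrite !in_itv/= !andbT gt_max.
    by move=> [-> ->].
  by move=> /andP.
- by move=> n; eexists.
- apply/seteqP; split => // x _.
  exists (Num.bound `|x|) => //=; rewrite in_itv/= andbT ltrNl.
  by rewrite (le_lt_trans (ler_norm _)) ?normrN ?archi_boundP.
- move=> _ [x ->].
  transitivity (1 - (real_cdf x)%:E)%E; last first.
    rewrite real_cdfE -(probability_setC (distribution P X))//.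
    by rewrite setCitvl.
  rewrite /distribution /pushforward/= preimage_quantile; case: ltP => x0.
    by rewrite probability_setT real_cdf_lt0// sube0.
  rewrite /U /uniform_prob integral_uniform_pdf.
  have -> : `]real_cdf x, 1[%classic `&` `[0, 1]%classic = `]real_cdf x, 1[%classic :> set R.
    apply/setIidPl => u /=; rewrite !in_itv/= => /andP[Fu u1].
    by rewrite (ltW u1) (le_trans (real_cdf_ge0 x)) ?ltW.
  transitivity (\int[lebesgue_measure]_(u in `]real_cdf x, 1%R[) cst 1%E u)%E.
    apply: eq_integral => u; rewrite inE/= in_itv/= => /andP[Fu u1].
    by rewrite /uniform_pdf (ltW u1) (le_trans (real_cdf_ge0 x)) ?ltW// subr0 invr1.
  rewrite integral_cst//= mul1e lebesgue_measure_itv/= lte_fin.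
  case: ltP => F1; first by [].
  have -> : real_cdf x = 1 by apply/eqP; rewrite eq_le real_cdf_le1 F1.
  by rewrite subee.
- by move=> n; rewrite (le_lt_trans (probability_le1 _ _)) ?ltry.
Qed.

End quantile.

Section sign_primitive.
Context (R : realType).
Notation mu := (@lebesgue_measure R).
Variable sg : R -> R.
Hypothesis msg : measurable_fun setT sg.
Hypothesis sg_norm : forall x, `|sg x| = 1.

Let g (x : R) := \int[mu]_(y in `[0, x]) sg y.

Let sg_int (a b : itv_bound R) :
  (mu [set` Interval a b] < +oo)%E ->
  mu.-integrable [set` Interval a b] (EFin \o sg).
Proof.
move=> ab; apply: measurable_bounded_integrable => //.
- exact: measurable_funTS.
- exists 1; split => // M M1 x _ /=.
  by rewrite sg_norm ltW.
Qed.

Let mu_itv_fin (b1 b2 : bool) (a b : R) :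
  (mu [set` Interval (BSide b1 a) (BSide b2 b)] < +oo)%E.
Proof. by rewrite lebesgue_measure_itv/=; case: ifP => _; rewrite ?ltry. Qed.

Lemma sign_primitiveB (a b : R) : 0 <= a -> a <= b ->
  g b - g a = \int[mu]_(y in `]a, b]) sg y.
Proof.
move=> a0 ab; rewrite /g Rintegral_itvB ?bnd_simp//.
exact/sg_int/mu_itv_fin.
Qed.

Lemma sign_primitive_lipschitz (a b : R) : 0 <= a -> a <= b ->
  `|g b - g a| <= b - a.
Proof.
move=> a0 ab; rewrite sign_primitiveB//.
apply: (le_trans (le_normr_Rintegral _ _)) => //.
  exact/sg_int/mu_itv_fin.
rewrite (_ : \int[mu]_(y in _) _ = \int[mu]_(y in `]a, b]) cst 1 y).
  rewrite Rintegral_cst//= lebesgue_measure_itv/= lte_fin mul1r.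
  by case: ltP => _ //=; rewrite subr_ge0.
by apply: eq_Rintegral => y _; rewrite sg_norm.
Qed.

(** Constancy is asked on [[a, b[], the form that [quantile_le] delivers; the end points are
    null. *)
Lemma sign_primitive_cst (a b s : R) : 0 <= a -> a <= b ->
  (forall x, a <= x < b -> sg x = s) -> g b - g a = s * (b - a).
Proof.
move=> a0 ab sgs; rewrite sign_primitiveB//.
rewrite Rintegral_itv_obnd_cbnd; last exact/sg_int/mu_itv_fin.
rewrite -Rintegral_itv_bndo_bndc; last exact/sg_int/mu_itv_fin.
transitivity (\int[mu]_(y in `[a, b[) cst s y).
  by apply: eq_Rintegral => y; rewrite inE/= in_itv/= => /sgs.
rewrite Rintegral_cst//= lebesgue_measure_itv/= lte_fin; case: ltP => //= ba.
by rewrite (_ : b = a) ?subrr//; apply/eqP; rewrite eq_le ba.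
Qed.

End sign_primitive.

Lemma lipschitz_continuous (R : realType) (f : R -> R) (C : R) :
  (forall x y, `|f x - f y| <= C * `|x - y|) -> continuous f.
Proof.
move=> fC x; apply/cvgrPdist_lt => e e0.
have C1 : 0 < `|C| + 1 by rewrite ltr_wpDl.
near=> y; apply: (le_lt_trans (fC x y)).
apply: (@le_lt_trans _ _ ((`|C| + 1) * `|x - y|)).
  by rewrite ler_wpM2r// (le_trans (ler_norm _)) ?lerDl.
rewrite -ltr_pdivlMl//; near: y; apply: cvgr_dist_lt => //.
by rewrite mulr_gt0 ?invr_gt0.
Unshelve. all: by end_near. Qed.

Section clip.
Context (R : realType).

Definition clip (b x : R) := Num.min (Num.max x 0) b.

Lemma clip_bounds b x : 0 <= b -> 0 <= clip b x <= b.
Proof. by move=> b0; rewrite /clip le_min le_max lexx orbT b0 ge_min lexx orbT. Qed.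

Lemma clip_ge0 b x : 0 <= b -> 0 <= clip b x.
Proof. by move=> /(clip_bounds x)/andP[]. Qed.

Lemma clip_id b x : 0 <= x <= b -> clip b x = x.
Proof. by move=> /andP[x0 xb]; rewrite /clip max_l// min_l. Qed.

Lemma clip_nd b x y : x <= y -> clip b x <= clip b y.
Proof. by move=> xy; rewrite /clip le_min2// le_max2. Qed.

Lemma clip_lip b x y : `|clip b x - clip b y| <= `|x - y|.
Proof.
wlog xy : x y / x <= y => [wlg|].
  have [xy|/ltW xy] := leP x y; first exact: wlg.
  by rewrite distrC (distrC x) wlg.
have cxy := clip_nd b xy.
rewrite distrC (distrC x) !ger0_norm ?subr_ge0// /clip /Num.min /Num.max.
by do 4 case: ifPn; rewrite -?leNgt; lra.
Qed.

End clip.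

(** * The quantile coupling against bounded Lipschitz functions *)

Section kantorovich.
Context (R : realType) (d1 d2 : measure_display).
Context (Omega1 : measurableType d1) (Omega2 : measurableType d2).
Variables (P1 : probability Omega1 R) (P2 : probability Omega2 R).
Variables (X : {RV P1 >-> R}) (Y : {RV P2 >-> R}).
Hypothesis X_ge0 : {ae P1, forall w, 0 <= X w}.
Hypothesis Y_ge0 : {ae P2, forall w, 0 <= Y w}.
Notation mu := (@lebesgue_measure R).

Let sg (x : R) : R := if real_cdf X x < real_cdf Y x then 1 else -1.

Let msg : measurable_fun setT sg.
Proof.
apply: measurable_fun_ifT => //; apply: measurable_fun_ltr.
  exact: measurable_real_cdf.
exact: measurable_real_cdf.
Qed.

Let sg_norm x : `|sg x| = 1.
Proof. by rewrite /sg; case: ifP => _; rewrite ?normrN normr1. Qed.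

(* The increment of this potential between two quantiles of the same order is
   the (clipped) distance between them: [sg] is constant on that interval. *)
Definition kantorovich_potential (K x : R) : R :=
  K + \int[mu]_(y in `[0, clip K x]) sg y.

Lemma kantorovich_potential_lipschitz K x y : 0 <= K ->
  `|kantorovich_potential K x - kantorovich_potential K y| <= `|x - y|.
Proof.
move=> K0; wlog xy : x y / x <= y => [wlg|].
  have [xy|/ltW xy] := leP x y; first exact: wlg.
  by rewrite distrC (distrC x) wlg.
rewrite distrC (distrC x) /kantorovich_potential opprD addrACA subrr add0r.
apply: le_trans (le_trans (ler_norm _) (clip_lip K y x)).
by apply: (sign_primitive_lipschitz msg sg_norm); [exact: clip_ge0|exact: clip_nd].
Qed.

Lemma kantorovich_potential_bounds K x : 0 <= K ->
  0 <= kantorovich_potential K x <= 2 * K.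
Proof.
move=> K0; have := sign_primitive_lipschitz msg sg_norm (lexx 0) (clip_ge0 x K0).
rewrite (_ : \int[mu]_(y in `[0, 0]) _ = 0) ?subr0 ?set_itv1 ?Rintegral_set1//.
rewrite ler_norml => /andP[h1 h2].
have cK : clip K x <= K by rewrite /clip ge_min lexx orbT.
by rewrite /kantorovich_potential; apply/andP; split; lra.
Qed.

Lemma kantorovich_potential_quantile K u : 0 <= K ->
  `|clip K (quantile X u) - clip K (quantile Y u)| +
    kantorovich_potential K (quantile Y u) =
  kantorovich_potential K (quantile X u).
Proof.
move=> K0; have [u01|u01] := boolP (0 < u < 1); last first.
  by rewrite /quantile (negbTE u01) subrr normr0 add0r.
have clipE (x y : R) : 0 <= y -> clip K y <= x -> x < K -> y <= x.
  by rewrite /clip => y0; rewrite max_l// ge_min => /orP[//|Kx] /(le_lt_trans Kx);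
    rewrite ltxx.
have clip_lt (x y : R) : 0 <= y -> x < clip K y -> x < y /\ x < K.
  by rewrite /clip => y0; rewrite max_l// lt_min => /andP.
have qX0 := quantile_ge0 X_ge0 u; have qY0 := quantile_ge0 Y_ge0 u.
rewrite /kantorovich_potential; have [XY|YX] := leP (quantile X u) (quantile Y u).
  rewrite distrC ger0_norm ?subr_ge0 ?clip_nd//.
  have := @sign_primitive_cst R sg msg sg_norm (clip K (quantile X u))
    (clip K (quantile Y u)) (-1) (clip_ge0 _ K0) (clip_nd K XY).
  set A := \int[mu]_(y in _) _; set B := \int[mu]_(y in _) _ => h.
  suff : A - B = -1 * (clip K (quantile Y u) - clip K (quantile X u)) by lra.
  (* For [quantile X u <= x < quantile Y u], [quantile_le] gives [real_cdf Y x < u <= real_cdf X x],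
     so [sg x = -1]; clipping is harmless because [x < K]. The other order is symmetric, with sign
     [1]. *)
  apply: h => x /andP[Xx /(clip_lt _ _ qY0)[xY xK]].
  have := clipE _ _ qX0 Xx xK; rewrite (quantile_le X_ge0)// => uF.
  rewrite /sg ifF//; apply/negbTE; rewrite -leNgt; apply: le_trans uF.
  by rewrite ltW// ltNge -(quantile_le Y_ge0)// -ltNge.
rewrite ger0_norm ?subr_ge0 ?clip_nd ?(ltW YX)//.
have := @sign_primitive_cst R sg msg sg_norm (clip K (quantile Y u))
  (clip K (quantile X u)) 1 (clip_ge0 _ K0) (clip_nd K (ltW YX)).
set A := \int[mu]_(y in _) _; set B := \int[mu]_(y in _) _ => h.
suff : A - B = 1 * (clip K (quantile X u) - clip K (quantile Y u)) by lra.
apply: h => x /andP[Yx /(clip_lt _ _ qX0)[xX xK]].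
have := clipE _ _ qY0 Yx xK; rewrite (quantile_le Y_ge0)// => uG.
rewrite /sg ifT//; apply: lt_le_trans uG.
by rewrite ltNge -(quantile_le X_ge0)// -ltNge.
Qed.

(** The distance is cut off at level [n] so that the potential attached to it is bounded. The cost
    of the quantile coupling is then a difference of expectations of a single test function, and
    Fatou removes the cut-off. *)
Lemma W1_le_lipschitz (C : R) :
  (forall (f : R -> R) (K : R), (forall x y, `|f x - f y| <= `|x - y|) ->
    (forall x, 0 <= f x <= K) ->
    (\int[P1]_w (f (X w))%:E <= \int[P2]_w (f (Y w))%:E + C%:E)%E) ->
  (W1 (distribution P1 X) (distribution P2 Y) <= C%:E)%E.
Proof.
move=> dual.
pose U := uniform_prob (@ltr01 R).
pose qX : measurableTypeR R -> R := quantile X.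
pose qY : measurableTypeR R -> R := quantile Y.
have mqX : measurable_fun setT qX by exact: measurable_quantile.
have mqY : measurable_fun setT qY by exact: measurable_quantile.
have mq : measurable_fun setT (fun u => (qX u, qY u)) by exact: measurable_fun_pair.
pose q : {mfun measurableTypeR R >-> (R * R)%type} :=
  HB.pack (fun u => (qX u, qY u)) (isMeasurableFun.Build _ _ _ _ _ mq).
have Pi_coupling : coupling (distribution P1 X) (distribution P2 Y) (distribution U q).
  split=> A mA.
    rewrite -(distribution_quantile X_ge0 mA) /distribution /pushforward/=.
    by congr (U _); apply/seteqP; split => u /=; [case|].
  rewrite -(distribution_quantile Y_ge0 mA) /distribution /pushforward/=.
  by congr (U _); apply/seteqP; split => u /=; [case|].
apply: (@le_trans _ _ (\int[distribution U q]_z (`|z.1 - z.2|)%:E)%E).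
  by apply: ereal_inf_lbound; exists (distribution U q).
have mdist : measurable_fun setT (fun z : R * R => (`|z.1 - z.2|)%:E).
  by apply/measurable_EFinP; apply: measurableT_comp => //; exact: measurable_funB.
rewrite ge0_integral_distribution//.
pose h n u := (`|clip n%:R (qX u) - clip n%:R (qY u)|)%:E.
have mclip (n : nat) (g : measurableTypeR R -> R) : measurable_fun setT g ->
    measurable_fun setT (fun u => clip n%:R (g u)).
  by move=> mg; apply: measurable_minr => //; exact: measurable_maxr.
have mh n : measurable_fun setT (h n).
  apply/measurable_EFinP; apply: measurableT_comp => //.
  by apply: measurable_funB; exact: mclip.
have h0 n u : setT u -> (0 <= h n u)%E by move=> _; rewrite lee_fin.
have hC n : (\int[U]_u h n u <= C%:E)%E.
  pose f := kantorovich_potential n%:R.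
  have f_lip x y : `|f x - f y| <= `|x - y| by exact: kantorovich_potential_lipschitz.
  have f_bnd x : 0 <= f x <= 2 * n%:R by exact: kantorovich_potential_bounds.
  have f0 x : (0 <= (f x)%:E)%E by rewrite lee_fin; case/andP: (f_bnd x).
  have mf : measurable_fun setT (EFin \o f).
    apply/measurable_EFinP; apply: continuous_measurable_fun.
    by apply: (@lipschitz_continuous _ _ 1) => x y; rewrite mul1r.
  have lawX : (\int[U]_u (f (qX u))%:E = \int[P1]_w (f (X w))%:E)%E.
    pose qX' : {mfun measurableTypeR R >-> R} :=
      HB.pack qX (isMeasurableFun.Build _ _ _ _ _ mqX).
    transitivity (\int[distribution U qX']_x (f x)%:E)%E.
      by rewrite ge0_integral_distribution.
    transitivity (\int[distribution P1 X]_x (f x)%:E)%E.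
      by apply: eq_measure_integral => A mA _; exact: distribution_quantile.
    by rewrite ge0_integral_distribution.
  have lawY : (\int[U]_u (f (qY u))%:E = \int[P2]_w (f (Y w))%:E)%E.
    pose qY' : {mfun measurableTypeR R >-> R} :=
      HB.pack qY (isMeasurableFun.Build _ _ _ _ _ mqY).
    transitivity (\int[distribution U qY']_x (f x)%:E)%E.
      by rewrite ge0_integral_distribution.
    transitivity (\int[distribution P2 Y]_x (f x)%:E)%E.
      by apply: eq_measure_integral => A mA _; exact: distribution_quantile.
    by rewrite ge0_integral_distribution.
  have sumE : (\int[U]_u h n u + \int[P2]_w (f (Y w))%:E =
      \int[P1]_w (f (X w))%:E)%E.
    rewrite -lawX -lawY -ge0_integralD//; last 2 first.
    - by move=> u _; first [exact: f0|exact: h0].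
    - exact: (measurableT_comp mf mqY).
    apply: eq_integral => u _; rewrite -EFinD; congr EFin.
    exact: kantorovich_potential_quantile.
  (* Finiteness allows the expectation of [f (Y w)] to be cancelled from both sides. *)
  have fY_fin : (\int[P2]_w (f (Y w))%:E)%E \is a fin_num.
    rewrite ge0_fin_numE; last exact: integral_ge0.
    apply: (@le_lt_trans _ _ (2 * n%:R)%:E); last exact: ltry.
    rewrite -(integral_probability_cst P2 (2 * n%:R)); apply: ge0_le_integral => //.
    - exact: (measurableT_comp mf).
    - by move=> w _; rewrite lee_fin; case/andP: (f_bnd (Y w)).
  have := dual f _ f_lip f_bnd; rewrite -sumE addeC.
  by rewrite leeD2lE.
apply: (@le_trans _ _ (\int[U]_u limn_einf (h ^~ u))%E); last first.
  apply: (le_trans (fatou U measurableT mh h0)).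
  exact: limn_einf_le.
apply: ge0_le_integral => //.
- by move=> u _; rewrite lee_fin.
- exact: (measurableT_comp mdist mq).
- rewrite /limn_einf; apply: measurableT_comp => //.
  by apply: measurable_fun_limn_esup => n; exact: measurableT_comp.
- move=> u _; rewrite (cvg_limn_einf_sup (l := `|qX u - qY u|%:E) _).1//.
  apply: cvg_near_cst; near=> n; rewrite /h /clip !max_l ?quantile_ge0//.
  have qXn : qX u <= n%:R by near: n; exact: nbhs_infty_ger.
  have qYn : qY u <= n%:R by near: n; exact: nbhs_infty_ger.
  by rewrite !min_l.
Unshelve. all: by end_near. Qed.

End kantorovich.

(** * Picard iterates of the semigroup *)

Section bounded_lipschitz.
Context (R : realType).
Notation mu := (@lebesgue_measure R).

(** The mean value theorem applied to [g - B] and to [- g - B]. In the Picard inductions the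
    derivative bound comes from the induction hypothesis, so this comparison takes the place of
    estimates of integrals. *)
Lemma is_derive_norm_le (g dg B dB : R -> R) (b : R) : 0 <= b ->
  continuous g -> continuous B ->
  (forall x : R, 0 < x < b -> is_derive x 1 g (dg x)) ->
  (forall x : R, 0 < x < b -> is_derive x 1 B (dB x)) ->
  (forall x, 0 < x < b -> `|dg x| <= dB x) ->
  `|g 0| <= B 0 -> `|g b| <= B b.
Proof.
move=> b0 cg cB gd Bd dgB g0; have [<-//|b_neq0] := eqVneq 0 b.
have {b_neq0}b_gt0 : 0 < b by rewrite lt_neqAle b_neq0.
have key (h dh : R -> R) : continuous h ->
    (forall x : R, 0 < x < b -> is_derive x 1 h (dh x)) ->
    (forall x, 0 < x < b -> dh x <= dB x) -> h 0 <= B 0 -> h b <= B b.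
  move=> ch hd dhB h0.
  have [||c cab] := @MVT R (h \- B) (dh \- dB) 0 b b_gt0.
  - move=> x; rewrite in_itv/= => xb.
    by have := is_deriveB (hd x xb) (Bd x xb).
  - by apply: continuous_subspaceT => x; apply: cvgB; [exact: ch|exact: cB].
  - rewrite subr0 /= => hE; move: cab; rewrite in_itv/= => cab.
    have : (dh c - dB c) * b <= 0 by rewrite mulr_le0_ge0// subr_le0 dhB.
    lra.
rewrite ler_norml; apply/andP; split; last first.
  apply: key gd _ _ => // [x /dgB|]; last exact: le_trans (ler_norm _) g0.
  exact: le_trans (ler_norm _).
rewrite lerNl; apply: (key (fun x => - g x) (fun x => - dg x)).
- by move=> x; apply: cvgN; exact: cg.
- by move=> x xb; have := is_deriveN (gd x xb).
- by move=> x /dgB; apply: le_trans; rewrite -normrN ler_norm.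
- by apply: le_trans g0; rewrite -normrN ler_norm.
Qed.

(** A qualitative class, stable under Picard steps: it yields continuity, integrability and joint
    measurability. Its constant grows with the iteration and never enters the final estimate. *)
Definition bounded_lipschitz (C : R) (g : R -> R -> R) : Prop :=
  [/\ 0 <= C, forall r m, `|g r m| <= C &
    forall r m r' m', `|g r m - g r' m'| <= C * (`|r - r'| + `|m - m'|)].

Lemma bounded_lipschitz_continuousl C g m :
  bounded_lipschitz C g -> continuous (g ^~ m).
Proof.
case=> _ _ gl; apply: (@lipschitz_continuous _ _ C) => x y.
by rewrite (le_trans (gl _ _ _ _))// subrr normr0 addr0.
Qed.

Lemma bounded_lipschitz_continuousr C g r :
  bounded_lipschitz C g -> continuous (g r).
Proof.
case=> _ _ gl; apply: (@lipschitz_continuous _ _ C) => x y.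
by rewrite (le_trans (gl _ _ _ _))// subrr normr0 add0r.
Qed.

Variable t : R.
Hypothesis t_ge0 : 0 <= t.

Lemma continuous_itv_integrable (g : R -> R) (a b : R) : continuous g ->
  mu.-integrable `[a, b] (EFin \o g).
Proof.
move=> cg; apply: continuous_compact_integrable; first exact: segment_compact.
exact: continuous_subspaceT.
Qed.

Lemma norm_Rintegral_le (g : R -> R) (a b c : R) : a <= b -> continuous g ->
  (forall x, a <= x <= b -> `|g x| <= c) ->
  `|\int[mu]_(x in `[a, b]) g x| <= c * (b - a).
Proof.
move=> ab cg gc.
apply: le_trans (le_normr_Rintegral _ (continuous_itv_integrable a b cg)) _ => //.
have -> : c * (b - a) = \int[mu]_(x in `[a, b]) cst c x.
  rewrite Rintegral_cst//= lebesgue_measure_itv/= lte_fin.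
  case: ltP => //= ba; rewrite (_ : b = a) ?subrr//.
  by apply/eqP; rewrite eq_le ba.
apply: le_Rintegral => //.
- apply: (continuous_itv_integrable a b (g := fun x => `|g x|)) => x.
  by apply: cvg_norm; exact: cg.
- by apply: (continuous_itv_integrable a b (g := cst c)) => x; exact: cvg_cst.
Qed.

(** Clipping the upper limit to [[0, t]] keeps the result bounded and Lipschitz for all real [r]. *)
Definition time_integral (f : R -> R) (g : R -> R -> R) (r m : R) : R :=
  f m + \int[mu]_(u in `[0, clip t r]) g u m.

Lemma time_integral0 f g m : time_integral f g 0 m = f m.
Proof.
by rewrite /time_integral clip_id ?lexx// set_itv1 Rintegral_set1 addr0.
Qed.

Lemma is_derive_time_integral C f g m (r : R) : bounded_lipschitz C g ->
  0 < r < t -> is_derive r 1 (time_integral f g ^~ m) (g r m).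
Proof.
move=> gC /andP[r0 rt].
have cg := bounded_lipschitz_continuousl (m := m) gC.
have [dF FE] := continuous_FTC1_closed rt (continuous_itv_integrable 0 t cg) r0 (cg r).
have dF' : is_derive r 1 (fun r => \int[mu]_(u in `[0, r]) g u m) (g r m).
  by apply: DeriveDef => //; rewrite -FE derive1E.
have := is_deriveD (is_derive_cst (f m) r 1) dF'; rewrite add0r => h.
apply: near_eq_is_derive h; near=> u; rewrite /time_integral clip_id//.
by apply/andP; split; apply: ltW; near: u; [exact: lt_nbhsr|exact: lt_nbhsl].
Unshelve. all: by end_near. Qed.

Lemma bounded_lipschitz_time_integral K C f g : bounded_lipschitz C g ->
  (forall x, `|f x| <= K) -> (forall x y, `|f x - f y| <= `|x - y|) ->
  bounded_lipschitz (K + C * t + C + 1) (time_integral f g).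
Proof.
move=> gC fK f_lip; have [C0 gb gl] := gC.
have K0 : 0 <= K by exact: le_trans (fK 0).
have cb r := clip_bounds r t_ge0.
have cg m := bounded_lipschitz_continuousl (m := m) gC.
split.
- by rewrite !addr_ge0// mulr_ge0.
- move=> r m; apply: (le_trans (ler_normD _ _)); rewrite -!addrA lerD//.
  have /andP[c0 ct] := cb r.
  have /(_ _)/le_trans := @norm_Rintegral_le (g ^~ m) 0 (clip t r) C c0 (cg m) _; apply.
    by [].
  by rewrite subr0 ler_wpDr ?addr_ge0// ler_wpM2l.
- move=> r m r' m'.
  have h1 : `|\int[mu]_(u in `[0, clip t r]) g u m -
      \int[mu]_(u in `[0, clip t r]) g u m'| <= C * `|m - m'| * t.
    rewrite -RintegralB//; [|exact: (continuous_itv_integrable _ _ (cg _))..].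
    have /andP[c0 ct] := cb r.
    apply: (@le_trans _ _ (C * `|m - m'| * (clip t r - 0))); last first.
      by rewrite subr0 ler_wpM2l// mulr_ge0.
    apply: (@norm_Rintegral_le (fun u => g u m - g u m')) => //.
      by move=> u; apply: cvgB; exact: cg.
    by move=> u _; rewrite (le_trans (gl _ _ _ _))// subrr normr0 add0r.
  have h2 a b : `|\int[mu]_(u in `[0, clip t a]) g u m' -
      \int[mu]_(u in `[0, clip t b]) g u m'| <= C * `|a - b|.
    wlog ab : a b / clip t a <= clip t b => [wlg|].
      have [ab|/ltW ab] := leP (clip t a) (clip t b); first exact: wlg.
      by rewrite distrC (distrC a) wlg.
    have /andP[c0 ct] := cb a.
    rewrite distrC Rintegral_itvB ?bnd_simp//; last first.
      exact: (continuous_itv_integrable _ _ (cg _)).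
    rewrite Rintegral_itv_obnd_cbnd; last first.
      apply: (integrableS _ _ _ (continuous_itv_integrable (clip t a) (clip t b) (cg m'))) => //.
      exact: subset_itv_oc_cc.
    apply: (@le_trans _ _ (C * (clip t b - clip t a))).
      by apply: norm_Rintegral_le.
    by rewrite ler_wpM2l// (le_trans (ler_norm _))// distrC clip_lip.
  have h2' := h2 r r'.
  rewrite /time_integral; move: h1 h2'.
  set I1 := \int[mu]_(u in _) _; set I2 := \int[mu]_(u in _) _.
  set I3 := \int[mu]_(u in _) _ => h1 h3.
  (* [m] is changed first, at a fixed upper limit, then the upper limit is changed. *)
  have -> : f m + I1 - (f m' + I3) = (f m - f m') + (I1 - I2) + (I2 - I3) by ring.
  apply: (le_trans (ler_normD _ _)); apply: (le_trans (lerD (ler_normD _ _) (lexx _))).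
  apply: (le_trans (lerD (lerD (f_lip m m') h1) h3)).
  set x := `|r - r'|; set y := `|m - m'|.
  have x0 : 0 <= x by exact: normr_ge0.
  have y0 : 0 <= y by exact: normr_ge0.
  have Kx : 0 <= K * x by exact: mulr_ge0.
  have Ky : 0 <= K * y by exact: mulr_ge0.
  have Cx : 0 <= C * x by exact: mulr_ge0.
  have Cy : 0 <= C * y by exact: mulr_ge0.
  have Ctx : 0 <= C * x * t by exact: mulr_ge0.
  have Cty : 0 <= C * y * t by exact: mulr_ge0.
  lra.
Qed.

End bounded_lipschitz.

Section picard.
Context (R : realType) (H : probability R R).
Hypothesis Hsupp : H `[0, 1[%classic = 1%E.
Variables (a N t : R).
Hypotheses (a_gt0 : 0 < a) (N_ge0 : 0 <= N) (t_ge0 : 0 <= t).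

Let k := kappa1 H.
Let cl (q : R) := Num.min `|q| 1.

Let cl01 q : 0 <= cl q <= 1.
Proof. by rewrite /cl le_min normr_ge0 ler01 ge_min lexx orbT. Qed.

Let mcl : measurable_fun setT cl.
Proof. by apply: measurable_minr => //; exact: measurableT_comp. Qed.

Lemma Rintegral_affine_clipped_factor (A B : R) : 0 <= A -> 0 <= B ->
  \int[H]_q (A * cl q + B) = A * (1 - k) + B.
Proof. by move=> A0 B0; rewrite /Rintegral integral_affine_clipped_factor. Qed.

Lemma kappa1_le1 : k <= 1.
Proof.
have := Rintegral_affine_clipped_factor ler01 (lexx 0).
rewrite mul1r addr0 => h; rewrite -subr_ge0 -h; apply: Rintegral_ge0 => q _.
by rewrite mul1r addr0; case/andP: (cl01 q).
Qed.

(** A bound affine in [cl q] lets the mean [1 - k] of the factor enter; [A = 0] gives the plain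
    uniform bound. *)
Lemma norm_Rintegral_factor_le (phi : R -> R) (C A B : R) : 0 <= A -> 0 <= B ->
  measurable_fun setT phi -> (forall q, `|phi q| <= C) ->
  (forall q, `|phi q| <= A * cl q + B) -> `|\int[H]_q phi q| <= A * (1 - k) + B.
Proof.
move=> A0 B0 mphi phiC phiAB; rewrite -Rintegral_affine_clipped_factor//.
have iphi := bounded_integrable H mphi phiC.
apply: le_trans (le_normr_Rintegral _ iphi) _ => //.
apply: le_Rintegral => //.
- apply: (@bounded_integrable _ _ _ H (fun q => `|phi q|) C).
    exact: measurableT_comp.
  by move=> q; rewrite normr_id.
- apply: (@bounded_integrable _ _ _ H (fun q => A * cl q + B) (A + B)).
    by apply: measurable_funD => //; exact: measurable_funM.
  move=> q; have /andP[c0 c1] := cl01 q; rewrite ger0_norm ?addr_ge0 ?mulr_ge0//.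
  by rewrite lerD2r ler_piMr.
Qed.

(** The second argument of [g] is position plus remaining time, so landing at [cl q * x] is recorded
    as [cl q * x + r]. *)
Definition jump_average (g : R -> R -> R) (r x : R) : R :=
  \int[H]_q g r (cl q * x + r).

(* [r] is the remaining time and [m = x + r] is constant along the flow: the
   position is [m - r]. Jumping at rate [position + a] is jumping at the constant
   rate [N + a], where a jump is fictitious with the complementary rate. *)
Definition position (r m : R) : R := clip N (m - r).

Definition uniformized (g : R -> R -> R) (r m : R) : R :=
  (N - position r m) * g r m +
  (position r m + a) * jump_average g r (position r m).

Let pos_bounds r m : 0 <= position r m <= N.
Proof. exact: clip_bounds. Qed.

Let pos_lip r m r' m' :
  `|position r m - position r' m'| <= `|r - r'| + `|m - m'|.
Proof.
apply: le_trans (clip_lip _ _ _) _.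
rewrite (_ : m - r - (m' - r') = (m - m') - (r - r')); last by ring.
by rewrite (le_trans (ler_normB _ _))// addrC.
Qed.

Lemma measurable_jump (C : R) g r x : bounded_lipschitz C g ->
  measurable_fun setT (fun q => g r (cl q * x + r)).
Proof.
move=> gC; apply: (@measurableT_comp _ _ _ _ _ _ (g r)).
  apply: continuous_measurable_fun; exact: bounded_lipschitz_continuousr gC.
by apply: measurable_funD => //; exact: measurable_funM.
Qed.

Lemma jump_average_norm (C K : R) g r x : bounded_lipschitz C g ->
  (forall m, `|g r m| <= K) -> `|jump_average g r x| <= K.
Proof.
move=> gC gK; have K0 : 0 <= K by exact: le_trans (gK 0).
have := @norm_Rintegral_factor_le (fun q => g r (cl q * x + r)) K 0 K (lexx 0) K0
  (measurable_jump r x gC).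
by rewrite mul0r add0r; apply=> // q; rewrite mul0r add0r.
Qed.

Lemma jump_averageB (C C' : R) g g' r r' x x' :
  bounded_lipschitz C g -> bounded_lipschitz C' g' ->
  jump_average g r x - jump_average g' r' x' =
  \int[H]_q (g r (cl q * x + r) - g' r' (cl q * x' + r')).
Proof.
move=> gC gC'; have [_ gb _] := gC; have [_ gb' _] := gC'.
rewrite /jump_average RintegralB//.
  exact: (bounded_integrable H (measurable_jump r x gC) (fun q => gb r _)).
exact: (bounded_integrable H (measurable_jump r' x' gC') (fun q => gb' r' _)).
Qed.

Lemma jump_average_diff (C C' K : R) g g' r r' x x' :
  bounded_lipschitz C g -> bounded_lipschitz C' g' ->
  (forall q, 0 <= q <= 1 -> `|g r (q * x + r) - g' r' (q * x' + r')| <= K) ->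
  `|jump_average g r x - jump_average g' r' x'| <= K.
Proof.
move=> gC gC' gK; rewrite (jump_averageB _ _ _ _ gC gC').
have K0 : 0 <= K by apply: le_trans (gK 0 _); rewrite ?normr_ge0// lexx ler01.
have := @norm_Rintegral_factor_le
  (fun q => g r (cl q * x + r) - g' r' (cl q * x' + r')) K 0 K (lexx 0) K0.
rewrite mul0r add0r; apply.
- by apply: measurable_funB; [exact: measurable_jump gC|exact: measurable_jump gC'].
- by move=> q; exact: gK.
- by move=> q; rewrite mul0r add0r; exact: gK.
Qed.

Lemma bounded_lipschitz_uniformized (C : R) g : bounded_lipschitz C g ->
  bounded_lipschitz ((4 * (N + a) + 2) * C) (uniformized g).
Proof.
move=> gC; have [C0 gb gl] := gC; have a0 := ltW a_gt0.
have NaC : 0 <= (N + a) * C by rewrite mulr_ge0 ?addr_ge0.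
split.
- by rewrite mulr_ge0// addr_ge0// mulr_ge0// addr_ge0.
- move=> r m; have /andP[p0 pN] := pos_bounds r m.
  apply: (le_trans (ler_normD _ _)); rewrite !normrM.
  rewrite (ger0_norm (_ : 0 <= N - _)) ?subr_ge0// (ger0_norm (_ : 0 <= _ + a)) ?addr_ge0//.
  apply: (@le_trans _ _ ((N - position r m) * C + (position r m + a) * C)).
    by rewrite lerD// ler_wpM2l ?subr_ge0 ?addr_ge0// (jump_average_norm _ gC).
  by lra.
- move=> r m r' m'.
  have /andP[p0 pN] := pos_bounds r m; have /andP[p0' pN'] := pos_bounds r' m'.
  have pl := pos_lip r m r' m'.
  set D := `|r - r'| + `|m - m'| in pl *; have D0 : 0 <= D by rewrite addr_ge0.
  have CD : 0 <= C * D by exact: mulr_ge0.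
  have NCD : 0 <= (N + a) * (C * D) by rewrite mulr_ge0 ?addr_ge0.
  have h1 := gl r m r' m'; rewrite -/D in h1.
  have h2 : `|jump_average g r (position r m) - jump_average g r' (position r' m')|
      <= 3 * (C * D).
    apply: (jump_average_diff gC gC) => q /andP[q0 q1].
    apply: (le_trans (gl _ _ _ _)).
    rewrite (_ : 3 * (C * D) = C * (3 * D)); last by ring.
    rewrite ler_wpM2l//.
    rewrite (_ : q * position r m + r - (q * position r' m' + r') =
      q * (position r m - position r' m') + (r - r')); last by ring.
    have : `|q * (position r m - position r' m')| <= D.
      by rewrite normrM ger0_norm// (le_trans _ pl)// ler_piMl.
    have := ler_normD (q * (position r m - position r' m')) (r - r').
    have : `|r - r'| <= D by rewrite lerDl.
    lra.
  have h3 := gb r' m'.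
  have h4 : `|jump_average g r' (position r' m')| <= C by exact: jump_average_norm gC _.
  move: p0 pN p0' pN' pl h2 h4; rewrite /uniformized.
  set p := position r m; set p' := position r' m'.
  set J := jump_average g r p; set J' := jump_average g r' p' => p0 pN p0' pN' pl h2 h4.
  (* The four terms below contribute [N + a], [1], [3 * (N + a)] and [1] times [C * D], whence the
     constant of the statement. *)
  have -> : (N - p) * g r m + (p + a) * J - ((N - p') * g r' m' + (p' + a) * J') =
    (N - p) * (g r m - g r' m') + (p' - p) * g r' m' + ((p + a) * (J - J') + (p - p') * J').
    by ring.
  have b1 : `|(N - p) * (g r m - g r' m')| <= (N + a) * (C * D).
    by rewrite normrM ger0_norm ?subr_ge0// ler_pM ?subr_ge0//; lra.
  have b2 : `|(p' - p) * g r' m'| <= C * D.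
    by rewrite normrM distrC mulrC ler_pM.
  have b3 : `|(p + a) * (J - J')| <= (N + a) * (3 * (C * D)).
    by rewrite normrM ger0_norm ?addr_ge0// ler_pM ?addr_ge0//; lra.
  have b4 : `|(p - p') * J'| <= C * D.
    by rewrite normrM mulrC ler_pM.
  apply: (le_trans (ler_normD _ _)); apply: (le_trans (lerD (ler_normD _ _) (ler_normD _ _))).
  lra.
Qed.

(** The weights [N - p] and [p + a] are nonnegative and add up to [N + a]. *)
Lemma uniformized_diff (C C' K : R) g g' r m :
  bounded_lipschitz C g -> bounded_lipschitz C' g' ->
  (forall m, `|g r m - g' r m| <= K) ->
  `|uniformized g r m - uniformized g' r m| <= (N + a) * K.
Proof.
move=> gC gC' gK; have /andP[p0 pN] := pos_bounds r m.
have hJ : `|jump_average g r (position r m) - jump_average g' r (position r m)| <= K.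
  by apply: (jump_average_diff gC gC') => q _; exact: gK.
rewrite /uniformized (_ : _ - _ = (N - position r m) * (g r m - g' r m) +
  (position r m + a) * (jump_average g r (position r m) -
    jump_average g' r (position r m))); last by ring.
apply: (le_trans (ler_normD _ _)); rewrite !normrM.
rewrite (ger0_norm (_ : 0 <= N - _)) ?subr_ge0//.
rewrite (ger0_norm (_ : 0 <= _ + a)) ?addr_ge0// ?(ltW a_gt0)//.
apply: (@le_trans _ _ ((N - position r m) * K + (position r m + a) * K)); last lra.
by rewrite lerD// ler_wpM2l ?subr_ge0 ?addr_ge0// ltW.
Qed.

(** Synchronous coupling in analytic form. With [p' <= p], the clock [N + a] splits into [N - p] (no
    jump), [p' + a] (both jump, with the same factor [q]) and [p - p'] (only the higher one jumps).
    The last two give at most [L * (p - p') * ((p' + a) * q + p - q * p')]; the terms [q * p']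
    cancel, and averaging [a * q + p] brings out [a * k]. *)
Lemma uniformized_lipschitz (C L : R) g r m m' : bounded_lipschitz C g -> 0 <= L ->
  (forall m m', r <= m -> r <= m' -> `|g r m - g r m'| <= L * `|m - m'|) ->
  r <= m -> r <= m' ->
  `|uniformized g r m - uniformized g r m'| <= (N + a - a * k) * (L * `|m - m'|).
Proof.
move=> gC L0 gL; wlog mm : m m' / m' <= m => [wlg|] rm rm'.
  have [mm|/ltW mm] := leP m' m; first exact: wlg.
  by rewrite distrC (distrC m) wlg.
have [C0 gb _] := gC; have a0 := ltW a_gt0.
have /andP[p0 pN] := pos_bounds r m; have /andP[p0' pN'] := pos_bounds r m'.
have pD : position r m - position r m' <= m - m'.
  rewrite (le_trans (ler_norm _))// (le_trans (pos_lip _ _ _ _))//.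
  by rewrite subrr normr0 add0r ger0_norm// subr_ge0.
have pp : position r m' <= position r m.
  by rewrite /position /clip le_min2// le_max2// lerD2r.
(* If the two positions differ, the lower one is below [N] and hence not clipped. *)
have p'E : position r m' < position r m -> position r m' = m' - r.
  move=> p'p; have p'N := lt_le_trans p'p pN; move: p'N.
  rewrite /position /clip max_l ?subr_ge0// gt_min ltxx orbF => m'N.
  by rewrite min_l// ltW.
rewrite (ger0_norm (_ : 0 <= m - m')) ?subr_ge0//.
move: p0 pN p0' pN' pD pp p'E; rewrite /uniformized.
set p := position r m; set p' := position r m' => p0 pN p0' pN' pD pp p'E.
pose phi q := (p' + a) * (g r (cl q * p + r) - g r (cl q * p' + r)) +
  (p - p') * (g r (cl q * p + r) - g r m').
have mphi1 : measurable_fun setT (fun q => g r (cl q * p + r) - g r (cl q * p' + r)).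
  by apply: measurable_funB; exact: measurable_jump gC.
have mphi2 : measurable_fun setT (fun q => g r (cl q * p + r) - g r m').
  by apply: measurable_funB => //; exact: measurable_jump gC.
have bphi1 q : `|g r (cl q * p + r) - g r (cl q * p' + r)| <= 2 * C.
  by rewrite (le_trans (ler_normB _ _))// mulr_natl mulr2n lerD.
have bphi2 q : `|g r (cl q * p + r) - g r m'| <= 2 * C.
  by rewrite (le_trans (ler_normB _ _))// mulr_natl mulr2n lerD.
have iphi1 := bounded_integrable H mphi1 bphi1.
have iphi2 := bounded_integrable H mphi2 bphi2.
have phiE : \int[H]_q phi q = (p + a) * jump_average g r p -
    (p' + a) * jump_average g r p' - (p - p') * g r m'.
  have iZ c (psi : R -> R) : measurable_fun setT psi -> (forall q, `|psi q| <= 2 * C) ->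
      H.-integrable setT (EFin \o (fun q => c * psi q)).
    move=> mpsi bpsi; apply: (@bounded_integrable _ _ _ H _ (`|c| * (2 * C))).
      exact: measurable_funM.
    by move=> q; rewrite normrM ler_wpM2l.
  rewrite RintegralD//; last 2 first.
  - exact: iZ mphi1 bphi1.
  - exact: iZ mphi2 bphi2.
  rewrite !RintegralZl// -(jump_averageB _ _ _ _ gC gC).
  rewrite RintegralB//; last 2 first.
  - exact: (bounded_integrable H (measurable_jump r p gC) (fun q => gb r _)).
  - by apply: (@bounded_integrable _ _ _ H (cst (g r m')) C) => // q; exact: gb.
  by rewrite Rintegral_probability_cst -/(jump_average g r p); ring.
have pp0 : 0 <= p - p' by rewrite subr_ge0.
have bound : `|\int[H]_q phi q| <= (p - p') * L * a * (1 - k) + (p - p') * L * p.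
  apply: (@norm_Rintegral_factor_le phi ((p' + a) * (2 * C) + (p - p') * (2 * C))).
  - by rewrite !mulr_ge0.
  - by rewrite !mulr_ge0.
  - by apply: measurable_funD; exact: measurable_funM.
  - move=> q; apply: (le_trans (ler_normD _ _)); rewrite !normrM.
    rewrite (ger0_norm (addr_ge0 p0' a0)) (ger0_norm pp0).
    by rewrite lerD// ler_wpM2l// addr_ge0.
  - move=> q; have /andP[q0 q1] := cl01 q.
    apply: (le_trans (ler_normD _ _)); rewrite !normrM.
    rewrite (ger0_norm (addr_ge0 p0' a0)) (ger0_norm pp0).
    have g1 : `|g r (cl q * p + r) - g r (cl q * p' + r)| <= L * (cl q * (p - p')).
      apply: (le_trans (gL _ _ _ _)); rewrite ?lerDr ?mulr_ge0//.
      rewrite (_ : cl q * p + r - _ = cl q * (p - p')); last by ring.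
      by rewrite ger0_norm// mulr_ge0.
    have g2 : (p - p') * `|g r (cl q * p + r) - g r m'| <=
        (p - p') * (L * (p - cl q * p')).
      move: pp; rewrite le_eqVlt => /predU1P[->|p'p].
        by rewrite subrr !mul0r.
      rewrite ler_wpM2l//; apply: (le_trans (gL _ _ _ _)) => //.
        by rewrite lerDr mulr_ge0.
      rewrite ler_wpM2l// (_ : cl q * p + r - m' = cl q * p - p'); last first.
        by rewrite p'E//; ring.
      have h1 : cl q * p <= p by rewrite ler_piMl.
      have h2 : cl q * p' <= p' by rewrite ler_piMl.
      rewrite ler_norml; apply/andP; split; last by lra.
      (* This is the lower half of [|q * p - p'| <= p - q * p']. *)
      have h3 : 0 <= (1 + cl q) * (p - p') by rewrite mulr_ge0// addr_ge0.
      lra.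
    apply: (le_trans (lerD (ler_wpM2l (addr_ge0 p0' a0) g1) g2)).
    lra.
have -> : (N - p) * g r m + (p + a) * jump_average g r p -
    ((N - p') * g r m' + (p' + a) * jump_average g r p') =
    (N - p) * (g r m - g r m') + \int[H]_q phi q.
  by rewrite phiE; ring.
have NgD : `|(N - p) * (g r m - g r m')| <= (N - p) * (L * (m - m')).
  rewrite normrM ger0_norm ?subr_ge0// ler_wpM2l ?subr_ge0//.
  by rewrite (le_trans (gL _ _ rm rm'))// ger0_norm// subr_ge0.
apply: (le_trans (ler_normD _ _)); apply: (le_trans (lerD NgD bound)).
have k1 := kappa1_le1.
(* Clipping at [N] may make [p - p'] smaller than [m - m']; the bound is raised to one in [m - m'],
   its coefficient being nonnegative as [k <= 1]. *)
have : 0 <= L * (a * (1 - k) + p) * (m - m' - (p - p')).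
  by rewrite mulr_ge0 ?subr_ge0// mulr_ge0// addr_ge0// mulr_ge0 ?subr_ge0.
lra.
Qed.

End picard.

Section picard_iteration.
Context (R : realType) (H : probability R R).
Hypothesis Hsupp : H `[0, 1[%classic = 1%E.
Variables (a N t : R).
Hypotheses (a_gt0 : 0 < a) (N_ge0 : 0 <= N) (t_ge0 : 0 <= t).
Variables (f : R -> R) (K : R).
Hypothesis f_lip : forall x y, `|f x - f y| <= `|x - y|.
Hypothesis f_bound : forall x, `|f x| <= K.

Let k := kappa1 H.
Let lam := N + a.
Let K_ge0 : 0 <= K. Proof. exact: le_trans (f_bound 0). Qed.
Let lam_gt0 : 0 < lam. Proof. by rewrite ltr_wpDl. Qed.

(** In the variables [r] and [m] transport disappears, and the loss term of the clock is removed by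
    a factor [expR (lam * r)], compensated in [semigroup_iterate]. What remains is a linear
    differential equation in [r] driven by the bounded operator [uniformized]. *)
Fixpoint picard (n : nat) : R -> R -> R :=
  if n is n'.+1 then time_integral t f (uniformized H a N (picard n'))
  else fun _ m => f m.

Lemma picard_bounded_lipschitz n : exists C, bounded_lipschitz C (picard n).
Proof.
elim: n => [|n [C nC]].
  exists (K + 1); split; first by rewrite addr_ge0.
    by move=> r m; rewrite /= (le_trans (f_bound m))// lerDl.
  move=> r m r' m' /=; apply: (le_trans (f_lip m m')).
  have r0 : 0 <= `|r - r'| by exact: normr_ge0.
  have m0 : 0 <= `|m - m'| by exact: normr_ge0.
  have K1 := mulr_ge0 K_ge0 r0; have K2 := mulr_ge0 K_ge0 m0; lra.
have uC := bounded_lipschitz_uniformized Hsupp a_gt0 N_ge0 nC.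
by eexists; exact: bounded_lipschitz_time_integral uC f_bound f_lip.
Qed.

Lemma picard0 n m : picard n 0 m = f m.
Proof. by case: n => //= n; rewrite time_integral0. Qed.

Lemma picard_continuous n m : continuous (picard n ^~ m).
Proof.
have [C nC] := picard_bounded_lipschitz n.
exact: (bounded_lipschitz_continuousl (m := m) nC).
Qed.

Lemma picard_derive n (r m : R) : 0 < r < t ->
  is_derive r 1 (picard n.+1 ^~ m) (uniformized H a N (picard n) r m).
Proof.
have [C nC] := picard_bounded_lipschitz n.
exact: is_derive_time_integral
  (bounded_lipschitz_uniformized Hsupp a_gt0 N_ge0 nC).
Qed.

Lemma is_derive_expRM (c l r : R) :
  is_derive r 1 (fun r : R => c * expR (l * r)) (c * l * expR (l * r)).
Proof.
have dl : is_derive r 1 (fun r : R => l * r) l.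
  by apply: is_derive_eq; rewrite /GRing.scale/= mulr1.
have de := @is_derive1_comp _ _ (fun r : R => l * r) _ _ _ (is_derive_expR _) dl.
apply: (is_derive_eq (is_deriveM (is_derive_cst (c : R) r 1) de)).
rewrite /GRing.scale/=; ring.
Qed.

Lemma continuous_expRM (c l : R) : continuous (fun r : R => c * expR (l * r)).
Proof. by move=> r; exact: is_derive1_continuous (is_derive_expRM c l r). Qed.

Let itv_sub (r x : R) : r <= t -> 0 < x < r -> 0 < x < t /\ 0 <= x <= t.
Proof. by move=> rt /andP[x0 xr]; split; lra. Qed.

Lemma picard_norm n r m : 0 <= r <= t -> `|picard n r m| <= K * expR (lam * r).
Proof.
elim: n r m => [|n IH] r m /andP[r0 rt].
  apply: (le_trans (f_bound m)); rewrite ler_peMr// -expR0 ler_expR mulr_ge0//.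
  exact: ltW.
have [C nC] := picard_bounded_lipschitz n.
apply: (@is_derive_norm_le _ (picard n.+1 ^~ m)
  (fun x => uniformized H a N (picard n) x m) (fun x => K * expR (lam * x))
  (fun x => K * lam * expR (lam * x)) r) => //.
- exact: picard_continuous.
- exact: continuous_expRM.
- by move=> x /(itv_sub rt)[xt _]; exact: picard_derive.
- by move=> x _; exact: is_derive_expRM.
- move=> x /(itv_sub rt)[_ xt].
  (* The operator norm is read off [uniformized_diff] by comparison with the zero function. *)
  have z0 : bounded_lipschitz 0 (fun _ _ : R => 0 : R).
    by split=> // *; rewrite ?subrr ?normr0 ?mul0r.
  have := uniformized_diff Hsupp a_gt0 N_ge0 m nC z0
    (K := K * expR (lam * x)) (r := x).
  rewrite {2}/uniformized /jump_average Rintegral_probability_cst !mulr0 addr0 subr0.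
  rewrite mulrA (mulrC _ K) -/lam; apply => m'.
  by rewrite subr0; exact: IH.
- by rewrite picard0 mulr0 expR0 mulr1.
Qed.

(* Since [uniformized] has norm at most [lam], each Picard step contracts by [1/2]
   relative to the weight [expR (2 * lam * r)]. *)
Lemma picard_diff n r m : 0 <= r <= t ->
  `|picard n.+1 r m - picard n r m| <= K * 2^-1 ^+ n * expR (2 * lam * r).
Proof.
elim: n r m => [|n IH] r m /andP[r0 rt].
  have [C nC] := picard_bounded_lipschitz 0%N.
  have dl : 0 <= 2 * lam by rewrite mulr_ge0// ltW.
  apply: (@is_derive_norm_le _ (fun x => picard 1 x m - f m)
    (fun x => uniformized H a N (picard 0%N) x m)
    (fun x => K * 2^-1 ^+ 0 * expR (2 * lam * x))
    (fun x => K * 2^-1 ^+ 0 * (2 * lam) * expR (2 * lam * x)) r) => //.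
  - by move=> x; apply: cvgB; [exact: picard_continuous|exact: cvg_cst].
  - exact: continuous_expRM.
  - move=> x /(itv_sub rt)[xt _].
    have := is_deriveB (picard_derive 0 m xt) (is_derive_cst (f m) x 1).
    by rewrite subr0.
  - by move=> x _; exact: is_derive_expRM.
  - move=> x /andP[x0 _].
    have z0 : bounded_lipschitz 0 (fun _ _ : R => 0 : R).
      by split=> // *; rewrite ?subrr ?normr0 ?mul0r.
    have := uniformized_diff Hsupp a_gt0 N_ge0 m nC z0 (K := K) (r := x).
    rewrite {2}/uniformized /jump_average Rintegral_probability_cst !mulr0 addr0 subr0.
    move=> h; apply: (@le_trans _ _ (lam * K)).
      by apply: h => m'; rewrite subr0; exact: f_bound.
    have e1 : 1 <= expR (2 * lam * x).
      by rewrite -[leLHS]expR0 ler_expR; exact: mulr_ge0 dl (ltW x0).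
    have lK : 0 <= lam * K by rewrite mulr_ge0// ltW.
    have : 0 <= lam * K * (expR (2 * lam * x) - 1) by rewrite mulr_ge0// subr_ge0.
    rewrite expr0; lra.
  - by rewrite picard0 subrr normr0 expr0 mulr1 mulr_ge0 ?expR_ge0.
have [C nC] := picard_bounded_lipschitz n.
have [C' nC'] := picard_bounded_lipschitz n.+1.
apply: (@is_derive_norm_le _ (fun x => picard n.+2 x m - picard n.+1 x m)
  (fun x => uniformized H a N (picard n.+1) x m - uniformized H a N (picard n) x m)
  (fun x => K * 2^-1 ^+ n.+1 * expR (2 * lam * x))
  (fun x => K * 2^-1 ^+ n.+1 * (2 * lam) * expR (2 * lam * x)) r) => //.
- by move=> x; apply: cvgB; exact: picard_continuous.
- exact: continuous_expRM.
- move=> x /(itv_sub rt)[xt _].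
  exact: is_deriveB (picard_derive n.+1 m xt) (picard_derive n m xt).
- by move=> x _; exact: is_derive_expRM.
- move=> x /(itv_sub rt)[_ xt].
  have := uniformized_diff Hsupp a_gt0 N_ge0 m nC' nC (r := x)
    (fun m' => IH x m' xt).
  rewrite -/lam => h; apply: (le_trans h).
  by rewrite exprS; lra.
- by rewrite !picard0 subrr normr0 mulr_ge0 ?expR_ge0// mulr_ge0// exprn_ge0.
Qed.

(** [r <= m] says that the position is nonnegative, and it persists at all smaller remaining times.
    Of the exponent, [lam] is compensated in [semigroup_iterate] and [- a * k] survives. *)
Lemma picard_contraction n r m m' : 0 <= r <= t -> r <= m -> r <= m' ->
  `|picard n r m - picard n r m'| <= expR ((lam - a * k) * r) * `|m - m'|.
Proof.
have k1 : k <= 1 by exact: kappa1_le1.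
have lak : 0 <= lam - a * k.
  rewrite subr_ge0 (@le_trans _ _ a)//; last by rewrite lerDr.
  by rewrite ler_piMr// ltW.
elim: n r m m' => [|n IH] r m m' /andP[r0 rt] rm rm'.
  apply: (le_trans (f_lip m m')); rewrite ler_peMl// -expR0 ler_expR mulr_ge0//.
have [C nC] := picard_bounded_lipschitz n.
rewrite mulrC.
apply: (@is_derive_norm_le _ (fun x => picard n.+1 x m - picard n.+1 x m')
  (fun x => uniformized H a N (picard n) x m - uniformized H a N (picard n) x m')
  (fun x => `|m - m'| * expR ((lam - a * k) * x))
  (fun x => `|m - m'| * (lam - a * k) * expR ((lam - a * k) * x)) r) => //.
- by move=> x; apply: cvgB; exact: picard_continuous.
- exact: continuous_expRM.
- move=> x /(itv_sub rt)[xt _].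
  exact: is_deriveB (picard_derive n m xt) (picard_derive n m' xt).
- by move=> x _; exact: is_derive_expRM.
- move=> x xr; have [_ xt] := itv_sub rt xr; case/andP: xr => x0 xr.
  have := @uniformized_lipschitz _ _ Hsupp a N a_gt0 N_ge0 C
    (expR ((lam - a * k) * x)) _ x m m' nC (expR_ge0 _)
    (fun m1 m2 => IH x m1 m2 xt) (ltW (lt_le_trans xr rm)) (ltW (lt_le_trans xr rm')).
  by rewrite -/lam -/k; lra.
- by rewrite !picard0 mulr0 expR0 mulr1.
Qed.

End picard_iteration.

(** By the Lipschitz bound, [g r x] is the supremum over rational [q] of [g q x - C * |r - q|], and
    each of these functions is measurable. *)
Lemma bounded_lipschitz_measurable (R : realType) (C : R) (g : R -> R -> R) :
  bounded_lipschitz C g -> measurable_fun setT (fun p : R * R => g p.1 p.2).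
Proof.
move=> gC; have [C0 _ gl] := gC.
apply: (measurability _ (RGenOInfty.measurableE R)) => //.
move=> /= _ [_ [y ->] <-]; rewrite setTI.
rewrite [X in measurable X](_ : _ = \bigcup_(q : rat)
  ((fun p : R * R => g (ratr q) p.2 - C * `|p.1 - ratr q|) @^-1` `]y, +oo[)).
  apply: bigcupT_measurable_rat => q; rewrite -[X in measurable X]setTI.
  have : measurable_fun setT (fun p : R * R => g (ratr q) p.2 - C * `|p.1 - ratr q|).
    apply: measurable_funB.
      apply: (@measurableT_comp _ _ _ _ _ _ (g (ratr q))) => //.
      apply: continuous_measurable_fun; exact: bounded_lipschitz_continuousr gC.
    apply: measurable_funM => //; apply: measurableT_comp => //.
    exact: measurable_funB.
  by apply => //; exact: measurable_itv.
have gq (p : R * R) q : g (ratr q) p.2 - C * `|p.1 - ratr q| <= g p.1 p.2 /\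
    g p.1 p.2 - 2 * (C * `|p.1 - ratr q|) <= g (ratr q) p.2 - C * `|p.1 - ratr q|.
  have := gl p.1 p.2 (ratr q) p.2; rewrite subrr normr0 addr0 ler_norml => /andP[h1 h2].
  by split; lra.
apply/seteqP; split=> [p|p [q _]]; rewrite /= !in_itv/= !andbT => yg; last first.
  by rewrite (lt_le_trans yg)//; case: (gq p q).
(* The loss at a rational within [e] of [p.1] is at most [2 * C * e], strictly less than the margin
   [(2 * C + 1) * e]. *)
pose e := (g p.1 p.2 - y) / (2 * C + 1).
have C1 : 0 < 2 * C + 1 by rewrite ltr_wpDl// mulr_ge0.
have e0 : 0 < e by rewrite divr_gt0// subr_gt0.
have : p.1 < p.1 + e by rewrite ltrDl.
move=> /rat_in_itvoo[q]; rewrite in_itv/= => /andP[pq qe].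
exists q => //; rewrite /= in_itv/= andbT; apply: lt_le_trans (gq p q).2.
have pqe : `|p.1 - ratr q| < e by rewrite ltr0_norm; lra.
rewrite ltrBrDr -ltrBrDl.
apply: (@le_lt_trans _ _ (2 * C * e)); first by rewrite mulrA ler_wpM2l ?mulr_ge0// ltW.
have -> : g p.1 p.2 - y = (2 * C + 1) * e by rewrite /e; field; rewrite gt_eqF.
lra.
Qed.

Lemma signed_perturbation_le (R : realType) (sg E V U U' eps : R) :
  `|sg| = 1 -> 0 <= E -> E <= 1 -> `|U' - U| <= eps ->
  sg * (E * (V - U)) - eps <= sg * (E * (V - U')).
Proof.
move=> sg1 E0 E1 UU; rewrite lerBlDr -lerBlDl -mulrBr -mulrBr.
apply: (le_trans (ler_norm _)); rewrite normrM sg1 mul1r normrM ger0_norm//.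
rewrite (_ : V - U - _ = U' - U); last by ring.
exact: le_trans (ler_piMl (normr_ge0 _) E1) UU.
Qed.

(** * Perturbed iterates as supersolutions, for both signs *)

Section approximate_semigroup.
Context (R : realType) (H : probability R R).
Hypothesis Hsupp : H `[0, 1[%classic = 1%E.
Variables (a M t : R).
Hypotheses (a_gt0 : 0 < a) (M_ge0 : 0 <= M) (t_ge0 : 0 <= t).
Variables (f : R -> R) (K : R).
Hypothesis f_lip : forall x y, `|f x - f y| <= `|x - y|.
Hypothesis f_bound : forall x, `|f x| <= K.

Let k := kappa1 H.
Let N := M + t.
Let lam := N + a.
Let N_ge0 : 0 <= N. Proof. exact: addr_ge0. Qed.
Let lam_gt0 : 0 < lam. Proof. by rewrite ltr_wpDl. Qed.
Let K_ge0 : 0 <= K. Proof. exact: le_trans (f_bound 0). Qed.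
Let v n := picard H a N t f n.

(** Here [r] is elapsed time; the remaining time used by [picard] is [t - r]. *)
Definition semigroup_iterate (n : nat) (r x : R) : R :=
  expR (- (lam * (t - r))) * v n (t - r) (x + (t - r)).

Let phi := semigroup_iterate.

(* The drift [- eps * r] absorbs the defect of the [n]-th iterate in the backward
   equation, for both signs [sg]. The constants make the expression nonnegative
   for [0 <= r <= t], so that [Num.max 0] is inactive there. *)
Definition perturbed_iterate (n : nat) (eps sg : R) (p : R * R) : R :=
  Num.max 0 (K + eps * t + sg * phi n p.1 p.2 - eps * p.1).

Lemma semigroup_iterate_final n x : phi n t x = f x.
Proof.
by rewrite /phi /semigroup_iterate subrr mulr0 oppr0 expR0 mul1r /v picard0// addr0.
Qed.

Lemma semigroup_iterate_norm n r x : 0 <= r <= t -> `|phi n r x| <= K.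
Proof.
move=> /andP[r0 rt]; rewrite /phi /semigroup_iterate normrM gtr0_norm ?expR_gt0//.
have := @picard_norm _ _ Hsupp a N t a_gt0 N_ge0 t_ge0 f K f_lip f_bound n (t - r) (x + (t - r)).
rewrite -/lam -/(v n) => h.
have tr : 0 <= t - r <= t by lra.
apply: (@le_trans _ _ (expR (- (lam * (t - r))) * (K * expR (lam * (t - r))))).
  by rewrite ler_wpM2l ?expR_ge0// h.
by rewrite mulrCA -expRD addNr expR0 mulr1.
Qed.

Lemma semigroup_iterate_contraction n r x y : 0 <= r <= t -> 0 <= x -> 0 <= y ->
  `|phi n r x - phi n r y| <= expR (- (a * k * (t - r))) * `|x - y|.
Proof.
move=> /andP[r0 rt] x0 y0; rewrite /phi /semigroup_iterate -mulrBr normrM.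
rewrite gtr0_norm ?expR_gt0//.
have tr : 0 <= t - r <= t by lra.
have := @picard_contraction _ _ Hsupp a N t a_gt0 N_ge0 t_ge0 f K f_lip f_bound n
  (t - r) (x + (t - r)) (y + (t - r)) tr.
rewrite -/lam -/(v n) -/k !lerDr => /(_ x0 y0) h.
apply: (le_trans (ler_wpM2l (expR_ge0 _) h)).
rewrite mulrA -expRD (_ : x + (t - r) - (y + (t - r)) = x - y); last by ring.
by rewrite (_ : - (lam * _) + _ = - (a * k * (t - r)))//; ring.
Qed.

Lemma measurable_semigroup_iterate n :
  measurable_fun setT (fun p : R * R => phi n p.1 p.2).
Proof.
have [C nC] := picard_bounded_lipschitz Hsupp a_gt0 N_ge0 t_ge0 f_lip f_bound n.
have mtr : measurable_fun setT (fun p : R * R => t - p.1) by exact: measurable_funB.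
apply: measurable_funM.
  apply: (@measurableT_comp _ _ _ _ _ _ (@expR R)) => //.
  apply: (@measurableT_comp _ _ _ _ _ _ (@GRing.opp R)) => //.
  exact: measurable_funM.
apply: (@measurableT_comp _ _ _ _ _ _ (fun p : R * R => v n p.1 p.2)
  _ (fun p : R * R => (t - p.1, p.2 + (t - p.1)))).
  exact: bounded_lipschitz_measurable nC.
by apply: measurable_fun_pair => //; exact: measurable_funD.
Qed.

Lemma measurable_perturbed_iterate n eps sg :
  measurable_fun setT (perturbed_iterate n eps sg).
Proof.
apply: measurable_maxr => //; apply: measurable_funB; last exact: measurable_funM.
apply: measurable_funD => //; apply: measurable_funM => //.
exact: measurable_semigroup_iterate.
Qed.

Lemma perturbed_iterateE n eps sg r x : 0 <= eps -> `|sg| = 1 -> 0 <= r <= t ->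
  perturbed_iterate n eps sg (r, x) = K + eps * t + sg * phi n r x - eps * r.
Proof.
move=> eps0 sg1 rt; rewrite /perturbed_iterate max_r//=.
have : `|sg * phi n r x| <= K by rewrite normrM sg1 mul1r semigroup_iterate_norm.
rewrite ler_norml => /andP[h _].
have : 0 <= eps * (t - r) by rewrite mulr_ge0//; lra.
lra.
Qed.

(** The derivative of iterate [n.+1] involves iterate [n], whereas its average after a jump involves
    iterate [n.+1]. The mismatch is the change of [uniformized] between two successive iterates, at
    most [eps] by [picard_diff] whatever the sign [sg]. *)
Lemma perturbed_iterate_one_step (m : probability R R) n eps sg s p :
  (forall A, measurable A -> m A = exponential_prob 1 A) ->
  `|sg| = 1 -> lam * (K * 2^-1 ^+ n * expR (2 * lam * t)) <= eps ->
  0 <= s <= t -> chain_domain s M p ->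
  (\int[m]_e \int[H]_q
    (perturbed_iterate n.+1 eps sg (jump_step a s p `|e| (Num.min `|q| 1)))%:E <=
   (perturbed_iterate n.+1 eps sg p)%:E)%E.
Proof.
case: p => r x mE sg1 le_eps /andP[s0 st] [/= /andP[r0 rs] /andP[x0 xM]].
have eps0 : 0 <= eps.
  apply: le_trans le_eps; apply: mulr_ge0; first exact: ltW.
  by apply: mulr_ge0; [apply: mulr_ge0 => //; exact: exprn_ge0|exact: expR_ge0].
pose rho w := t - (r + w).
(* Position plus remaining time is conserved by the flow, so along it only the first argument of [v]
   varies. *)
pose mm := x + (t - r).
have mmE w : x + w + rho w = mm by rewrite /mm /rho; ring.
pose E w := expR (- (lam * rho w)).
pose psi w := K + eps * t + sg * (E w * v n.+1 (rho w) mm) - eps * (r + w).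
pose dpsi w := sg * (lam * (E w * v n.+1 (rho w) mm) -
  E w * uniformized H a N (v n) (rho w) mm) - eps.
pose J w := K + eps * t + sg * (E w * jump_average H (v n.+1) (rho w) (x + w))
  - eps * (r + w).
have [C nC] := picard_bounded_lipschitz Hsupp a_gt0 N_ge0 t_ge0 f_lip f_bound n.
have [C' nC'] := picard_bounded_lipschitz Hsupp a_gt0 N_ge0 t_ge0 f_lip f_bound n.+1.
have w_dom w : 0 <= w <= s - r -> 0 <= r + w <= t /\ 0 <= rho w <= t.
  by move=> /andP[w0 ws]; rewrite /rho; split; lra.
have drho (w : R) : is_derive w 1 rho (-1).
  have d1 := is_deriveB (is_derive_cst (t : R) w 1)
    (is_deriveD (is_derive_cst (r : R) w 1) (is_derive_id w 1)).
  by apply: (is_derive_eq d1); ring.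
have crho : continuous rho by move=> w; exact: is_derive1_continuous (drho w).
have dE (w : R) : is_derive w 1 E (lam * E w).
  have dl : is_derive w 1 (fun w => - (lam * rho w)) lam.
    apply: (is_derive_eq (is_deriveN (is_deriveM (is_derive_cst (lam : R) w 1) (drho w)))).
    by rewrite /GRing.scale/=; ring.
  apply: (is_derive_eq
    (@is_derive1_comp _ _ (fun w => - (lam * rho w)) _ _ _ (is_derive_expR _) dl)).
  by rewrite mulrC.
have cE : continuous E by move=> w; exact: is_derive1_continuous (dE w).
have cv : continuous (fun w => v n.+1 (rho w) mm).
  move=> w; apply: (@continuous_comp _ _ _ rho (v n.+1 ^~ mm)); first exact: crho.
  exact: (picard_continuous Hsupp a_gt0 N_ge0 t_ge0 f_lip f_bound).
have cst_cont (c : R) : continuous (fun _ : R => c) by move=> w; exact: cvg_cst.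
have depsr (w : R) : is_derive w 1 (fun w : R => eps * (r + w)) eps.
  apply: (is_derive_eq (is_deriveM (is_derive_cst (eps : R) w 1)
    (is_deriveD (is_derive_cst (r : R) w 1) (is_derive_id w 1)))).
  by rewrite /GRing.scale/=; ring.
have cepsr : continuous (fun w : R => eps * (r + w)).
  by move=> w; exact: is_derive1_continuous (depsr w).
have cu : continuous (fun w => uniformized H a N (v n) (rho w) mm).
  have uC := bounded_lipschitz_uniformized Hsupp a_gt0 N_ge0 nC.
  move=> w; apply: (@continuous_comp _ _ _ rho (uniformized H a N (v n) ^~ mm)).
    exact: crho.
  exact: (bounded_lipschitz_continuousl (m := mm) uC).
have cJ : continuous (fun w => jump_average H (v n.+1) (rho w) (x + w)).
  have [C0' _ vl] := nC'.
  apply: (@lipschitz_continuous _ _ (3 * C')) => w w'.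
  apply: (jump_average_diff Hsupp nC' nC') => q /andP[q0 q1].
  apply: (le_trans (vl _ _ _ _)).
  have -> : rho w - rho w' = w' - w by rewrite /rho; ring.
  have -> : q * (x + w) + rho w - (q * (x + w') + rho w') = (1 - q) * (w' - w).
    by rewrite /rho; ring.
  rewrite (distrC w) normrM (ger0_norm (_ : 0 <= 1 - q)) ?subr_ge0//.
  have d0 : 0 <= `|w' - w| by exact: normr_ge0.
  have : 0 <= C' * (`|w' - w| + q * `|w' - w|).
    by rewrite mulr_ge0// addr_ge0// mulr_ge0.
  lra.
have mPhi := measurable_perturbed_iterate n.+1 eps sg.
have Phi0 q : 0 <= perturbed_iterate n.+1 eps sg q by rewrite le_max lexx.
have xa : 0 < x + a by rewrite ltr_wpDl.
have cpsi : continuous psi.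
  move=> w; apply: cvgB; last exact: cepsr.
  apply: cvgD; first exact: cst_cont; apply: cvgM; first exact: cst_cont.
  by apply: cvgM; [exact: cE|exact: cv].
have cdpsi : continuous dpsi.
  move=> w; apply: cvgB; last exact: cst_cont.
  apply: cvgM; first exact: cst_cont; apply: cvgB; last first.
    by apply: cvgM; [exact: cE|exact: cu].
  apply: cvgM; first exact: cst_cont.
  by apply: cvgM; [exact: cE|exact: cv].
have cJJ : continuous J.
  move=> w; apply: cvgB; last exact: cepsr.
  apply: cvgD; first exact: cst_cont; apply: cvgM; first exact: cst_cont.
  by apply: cvgM; [exact: cE|exact: cJ].
have psiE w : 0 <= w <= s - r -> psi w = perturbed_iterate n.+1 eps sg (r + w, x + w).
  move=> /w_dom[rw _]; rewrite (perturbed_iterateE _ _ eps0 sg1 rw) /psi /phi /semigroup_iterate.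
  by rewrite -/(rho w) -/(E w) mmE.
have JE w : 0 <= w <= s - r ->
    (\int[H]_q (perturbed_iterate n.+1 eps sg (r + w, Num.min `|q| 1 * (x + w)))%:E =
     (J w)%:E)%E.
  move=> /w_dom[rw _].
  pose A0 := K + eps * t - eps * (r + w); pose B0 := sg * E w.
  pose h (q : R) := v n.+1 (rho w) (Num.min `|q| 1 * (x + w) + rho w).
  have mh : measurable_fun setT h := measurable_jump (rho w) (x + w) nC'.
  have [_ vb _] := nC'.
  have hb q : `|h q| <= C' by exact: vb.
  have ih := bounded_integrable H mh hb.
  have iBh : H.-integrable setT (EFin \o (fun q => B0 * h q)).
    apply: (@bounded_integrable _ _ _ H _ (`|B0| * C')).
      exact: measurable_funM.
    by move=> q; rewrite normrM ler_wpM2l.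
  have iA : H.-integrable setT (EFin \o (fun _ : R => A0)).
    by apply: (@bounded_integrable _ _ _ H _ `|A0|).
  have iAB : H.-integrable setT (EFin \o (fun q => A0 + B0 * h q)).
    apply: (@bounded_integrable _ _ _ H _ (`|A0| + `|B0| * C')).
      by apply: measurable_funD => //; exact: measurable_funM.
    by move=> q; rewrite (le_trans (ler_normD _ _))// normrM lerD// ler_wpM2l.
  transitivity (\int[H]_q (A0 + B0 * h q)%:E)%E.
    apply: eq_integral => q _; rewrite (perturbed_iterateE _ _ eps0 sg1 rw); congr EFin.
    rewrite /phi /semigroup_iterate -/(rho w) -/(E w) /A0 /B0 /h; ring.
  transitivity ((\int[H]_q (A0 + B0 * h q))%:E)%E.
    by rewrite /Rintegral fineK//; exact: integrable_fin_num iAB.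
  congr EFin; rewrite RintegralD//; rewrite RintegralZl//.
  rewrite Rintegral_probability_cst -/(jump_average H (v n.+1) (rho w) (x + w)).
  rewrite /J /A0 /B0; ring.
have psi_derive (w : R) : 0 < w < s - r -> is_derive w 1 psi (dpsi w).
  move=> /andP[w0 ws].
  have rt : 0 < rho w < t by rewrite /rho; lra.
  have dvr := picard_derive Hsupp a_gt0 N_ge0 t_ge0 f_lip f_bound n mm rt.
  have dv := @is_derive1_comp _ (v n.+1 ^~ mm) rho _ _ _ dvr (drho w).
  have d1 := is_deriveM (is_derive_cst (sg : R) w 1) (is_deriveM (dE w) dv).
  have d2 := is_deriveB (is_deriveD (is_derive_cst (K + eps * t : R) w 1) d1) (depsr w).
  apply: (is_derive_eq d2); rewrite /dpsi /GRing.scale/= !fctE -/(v n); ring.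
have psi_super w : 0 <= w <= s - r -> dpsi w <= (x + w + a) * (psi w - J w).
  move=> wsr; have [_ rt] := w_dom w wsr; case/andP: wsr => w0 ws.
  (* The choice [N = M + t] serves here: the position is at most [M] plus the elapsed time, so the
     clipping in [position] is inactive. *)
  have xwN : 0 <= x + w <= N by rewrite /N; lra.
  have posE : position N (rho w) mm = x + w.
    by rewrite /position (_ : mm - rho w = x + w) ?clip_id// -(mmE w); ring.
  have UE : uniformized H a N (v n.+1) (rho w) mm =
      (N - (x + w)) * v n.+1 (rho w) mm +
      (x + w + a) * jump_average H (v n.+1) (rho w) (x + w).
    by rewrite /uniformized posE.
  have Udiff := uniformized_diff Hsupp a_gt0 N_ge0 mm nC' nC (r := rho w)
    (fun m' => picard_diff Hsupp a_gt0 N_ge0 t_ge0 f_lip f_bound n m' rt).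
  have -> : (x + w + a) * (psi w - J w) = sg * (E w *
      (lam * v n.+1 (rho w) mm - uniformized H a N (v n.+1) (rho w) mm)).
    rewrite UE /psi /J /lam; ring.
  have -> : dpsi w = sg * (E w *
      (lam * v n.+1 (rho w) mm - uniformized H a N (v n) (rho w) mm)) - eps.
    rewrite /dpsi; ring.
  have E1 : E w <= 1.
    have lr : 0 <= lam * rho w by apply: mulr_ge0; [exact: ltW|case/andP: rt].
    by rewrite -expR0 ler_expR oppr_le0.
  apply: (signed_perturbation_le _ sg1 (expR_ge0 _) E1).
  apply: (le_trans Udiff); apply: le_trans le_eps.
  apply: ler_wpM2l; first exact: ltW.
  apply: ler_wpM2l.
    by apply: mulr_ge0; [exact: K_ge0|apply: exprn_ge0; rewrite invr_ge0 ler0n].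
  rewrite ler_expR; apply: ler_wpM2l.
    by apply: mulr_ge0; [rewrite ler0n|exact: ltW].
  by case/andP: rt.
exact: (one_step_le mE mPhi Phi0 xa rs cpsi cdpsi cJJ psiE JE psi_derive psi_super).
Qed.

End approximate_semigroup.

(** * Comparison of expectations *)

Section expectations.
Context (R : realType) (d : measure_display) (Omega : measurableType d).
Variable P : probability Omega R.

Lemma EFin_Rintegral_bounded (g : Omega -> R) (C : R) : measurable_fun setT g ->
  (forall w, `|g w| <= C) -> (\int[P]_w (g w)%:E = (\int[P]_w g w)%:E)%E.
Proof.
move=> mg gC; rewrite /Rintegral fineK//.
exact: integrable_fin_num (bounded_integrable P mg gC).
Qed.

Lemma EFin_Rintegral_affine (b c : R) (g : Omega -> R) (C : R) :
  measurable_fun setT g -> (forall w, `|g w| <= C) ->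
  (\int[P]_w (c + b * g w)%:E = (c + b * \int[P]_w g w)%:E)%E.
Proof.
move=> mg gC; have ig := bounded_integrable P mg gC.
have mbg : measurable_fun setT (fun w => b * g w) by exact: measurable_funM.
have bgC w : `|b * g w| <= `|b| * C by rewrite normrM ler_wpM2l.
have mcbg : measurable_fun setT (fun w => c + b * g w) by exact: measurable_funD.
have cbgC w : `|c + b * g w| <= `|c| + `|b| * C.
  by rewrite (le_trans (ler_normD _ _))// lerD.
rewrite (EFin_Rintegral_bounded mcbg cbgC) RintegralD//.
- by rewrite RintegralZl// Rintegral_probability_cst.
- by apply: (@bounded_integrable _ _ _ P _ `|c|).
- exact: (bounded_integrable P mbg bgC).
Qed.

Lemma Rintegral_close (g1 g2 h : Omega -> R) (C1 C2 c : R) :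
  measurable_fun setT g1 -> (forall w, `|g1 w| <= C1) ->
  measurable_fun setT g2 -> (forall w, `|g2 w| <= C2) ->
  measurable_fun setT h -> (forall w, 0 <= h w) ->
  {ae P, forall w, `|g1 w - g2 w| <= h w} -> (\int[P]_w (h w)%:E <= c%:E)%E ->
  `|\int[P]_w g1 w - \int[P]_w g2 w| <= c.
Proof.
move=> mg1 g1C mg2 g2C mh h0 gh hc.
have ig1 := bounded_integrable P mg1 g1C; have ig2 := bounded_integrable P mg2 g2C.
have mg : measurable_fun setT (fun w => g1 w - g2 w) by exact: measurable_funB.
have gC w : `|g1 w - g2 w| <= C1 + C2 by rewrite (le_trans (ler_normB _ _))// lerD.
rewrite -RintegralB//.
apply: le_trans (le_normr_Rintegral measurableT (bounded_integrable P mg gC)) _.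
have mng : measurable_fun setT (fun w => `|g1 w - g2 w|) by exact: measurableT_comp.
rewrite -lee_fin -(@EFin_Rintegral_bounded _ (C1 + C2))//; last first.
  by move=> w; rewrite normr_id.
apply: le_trans hc; apply: ae_ge0_le_integral => //.
- exact/measurable_EFinP.
- by move=> w _; rewrite lee_fin.
- exact/measurable_EFinP.
- by apply: filterS gh => w gw _; rewrite lee_fin.
Qed.

End expectations.

Section process_bound.
Context (R : realType) (H : probability R R) (a : R) (d : measure_display).
Variables (Omega : measurableType d) (P : probability Omega R).
Variable X : R -> {RV P >-> R}.
Hypothesis Hsupp : H `[0, 1[%classic = 1%E.
Hypothesis a_gt0 : 0 < a.
Hypothesis X_gen : generated_by_L a H X.

Definition bad_start (M : R) (w : Omega) : R :=
  if (0 <= X 0 w) && (X 0 w <= M) then 0 else 1.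

Let mbad M : measurable_fun setT (bad_start M).
Proof.
by apply: measurable_fun_ifT => //; apply: measurable_and; apply: measurable_fun_ler.
Qed.

Let bad_ge0 M w : 0 <= bad_start M w.
Proof. by rewrite /bad_start; case: ifP. Qed.

Lemma initial_tail (e : R) : 0 < e ->
  exists2 M0, 0 <= M0 & forall M, M0 <= M -> (\int[P]_w (bad_start M w)%:E <= e%:E)%E.
Proof.
move=> e0.
have cvg0 : fine (ccdf (X 0) r) @[r --> +oo] --> (0 : R).
  by apply: fine_cvg; exact: cvg_ccdfy0.
have [A [_ Ae]] : \forall r \near +oo, fine (ccdf (X 0) r) < e by exact: cvgr_lt cvg0 _ e0.
exists (Num.max 0 (A + 1)) => [|M]; first by rewrite le_max lexx.
rewrite ge_max => /andP[M0 AM].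
apply: (@le_trans _ _ (\int[P]_w (\1_(X 0 @^-1` `]M, +oo[) w)%:E)%E).
  apply: ae_ge0_le_integral => //.
  - by move=> w _; rewrite lee_fin bad_ge0.
  - exact/measurable_EFinP.
  - by apply/measurable_EFinP; apply: measurable_indic; exact: measurable_funPTI.
  - apply: filterS (generated_ge0 X_gen (lexx 0)) => w X0 _.
    rewrite lee_fin /bad_start X0 andTb; case: (leP (X 0 w) M) => [_|MX]; rewrite indicE//.
    by rewrite mem_set//= in_itv/= MX.
rewrite integral_indic//; last exact: measurable_funPTI.
rewrite setIT -[leLHS]/(ccdf (X 0) M) -[leLHS]fineK; last exact: fin_num_measure.
by rewrite lee_fin ltW// Ae//; lra.
Qed.

Variables (t s : R).
Hypotheses (s_gt0 : 0 < s) (st : s <= t).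
Variables (f : R -> R) (K : R).
Hypothesis f_lip : forall x y, `|f x - f y| <= `|x - y|.
Hypothesis f_bound : forall x, `|f x| <= K.

Let k := kappa1 H.
Let t_ge0 : 0 <= t. Proof. exact: le_trans (ltW s_gt0) st. Qed.

(** Used with both signs [sg]: the iterate evaluated along the process nearly keeps its expectation,
    up to [eps * t]. *)
Lemma iterate_expectation_le (M eps sg s' : R) (n : nat) :
  0 <= M -> `|sg| = 1 ->
  (M + t + a) * (K * 2^-1 ^+ n * expR (2 * (M + t + a) * t)) <= eps ->
  0 <= s' <= t ->
  sg * (\int[P]_w semigroup_iterate H a M t f n.+1 s' (truncated_position X M s' w)) <=
  sg * (\int[P]_w semigroup_iterate H a M t f n.+1
    (truncated_start s' M (X 0 w)).1 (truncated_start s' M (X 0 w)).2) + eps * t.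
Proof.
move=> M0 sg1 le_eps s't; have /andP[s'0 s'_le] := s't.
pose phi := semigroup_iterate H a M t f n.+1.
have K0 : 0 <= K by exact: le_trans (f_bound 0).
have eps0 : 0 <= eps.
  apply: le_trans le_eps; apply: mulr_ge0; first by rewrite !addr_ge0// ltW.
  by apply: mulr_ge0; [apply: mulr_ge0 => //; exact: exprn_ge0|exact: expR_ge0].
have conclude (I1 I2 : R) : K + eps * t - eps * s' + sg * I1 <= K + eps * t + sg * I2 ->
    sg * I1 <= sg * I2 + eps * t.
  have : 0 <= eps * (t - s') by rewrite mulr_ge0// subr_ge0.
  lra.
have phiK r x : 0 <= r <= t -> `|phi r x| <= K.
  exact: (semigroup_iterate_norm Hsupp a_gt0 M0 t_ge0 f_lip f_bound).
have start_t w : 0 <= (truncated_start s' M (X 0 w)).1 <= t.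
  by rewrite /truncated_start; case: ifP => _ /=; rewrite ?lexx ?t_ge0.
have mphi := measurable_semigroup_iterate Hsupp a_gt0 M0 t_ge0 f_lip f_bound n.+1.
have mstart : measurable_fun setT (fun w => truncated_start s' M (X 0 w)).
  by apply: measurableT_comp => //; exact: measurable_truncated_start.
pose g1 w := phi s' (truncated_position X M s' w).
pose g2 w := phi (truncated_start s' M (X 0 w)).1 (truncated_start s' M (X 0 w)).2.
have mg1 : measurable_fun setT g1.
  apply: (measurableT_comp mphi (g := fun w => (s', truncated_position X M s' w))).
  by apply: measurable_fun_pair => //; exact: measurable_truncated_position.
have mg2 : measurable_fun setT g2 by exact: (measurableT_comp mphi mstart).
have g1K w : `|g1 w| <= K by exact: phiK.
have g2K w : `|g2 w| <= K by exact: phiK.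
have ig1 := bounded_integrable P mg1 g1K.
have ig2 := bounded_integrable P mg2 g2K.
have Phi0 p : 0 <= perturbed_iterate H a M t f K n.+1 eps sg p.
  by rewrite le_max lexx.
have super := generated_supersolution Hsupp a_gt0 X_gen s'0 M0
  (measurable_perturbed_iterate Hsupp a_gt0 M0 t_ge0 f_lip f_bound n.+1 eps sg) Phi0
  (fun m mE p => perturbed_iterate_one_step Hsupp a_gt0 M0 t_ge0 f_lip f_bound
     mE sg1 le_eps s't).
have perE r x rt := perturbed_iterateE Hsupp a_gt0 M0 t_ge0 f_lip f_bound n.+1
  x eps0 sg1 (r := r) rt.
rewrite -/phi -/(g1 _) -/(g2 _).
have L : (\int[P]_w (perturbed_iterate H a M t f K n.+1 eps sg
    (s', truncated_position X M s' w))%:E =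
    (K + eps * t - eps * s' + sg * \int[P]_w g1 w)%:E)%E.
  rewrite -(EFin_Rintegral_affine P _ _ mg1 g1K); apply: eq_integral => w _.
  congr EFin; rewrite (perE _ _ s't) /g1 /phi; ring.
have U : (\int[P]_w (perturbed_iterate H a M t f K n.+1 eps sg
    (truncated_start s' M (X 0 w)))%:E <=
    (K + eps * t + sg * \int[P]_w g2 w)%:E)%E.
  rewrite -(EFin_Rintegral_affine P _ _ mg2 g2K); apply: ge0_le_integral.
  - exact: measurableT.
  - by move=> w _; rewrite lee_fin; exact: Phi0.
  - apply/measurable_EFinP; apply: (measurableT_comp _ mstart).
    exact: measurable_perturbed_iterate.
  - apply/measurable_EFinP; apply: measurable_funD; first exact: measurable_cst.
    by apply: measurable_funM; [exact: measurable_cst|exact: mg2].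
  - move=> w _; rewrite lee_fin /g2; move: (start_t w).
    case: (truncated_start s' M (X 0 w)) => r x /= rt.
    rewrite (perE _ _ rt) -/phi lerBlDr lerDl; apply: mulr_ge0 => //.
    by case/andP: rt.
by have := le_trans super U; rewrite L lee_fin => /conclude.
Qed.

Let contraction := expR (- (a * k * (t - s))).
Let moment := (Num.sqrt k * tanh (Num.sqrt k * s))^-1.

Lemma signed_telescope_le (sg u v w x y z b1 b2 b3 b4 b5 : R) : `|sg| = 1 ->
  `|u - v| <= b1 -> sg * u <= sg * w + b2 -> `|w - x| <= b3 ->
  - sg * y <= - sg * x + b4 -> `|y - z| <= b5 ->
  sg * (v - z) <= b1 + b2 + b3 + b4 + b5.
Proof.
move=> sg1 h1 h2 h3 h4 h5.
have S (p q b : R) : `|p - q| <= b -> sg * p - sg * q <= b.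
  by rewrite -mulrBr; apply: le_trans; rewrite -[leRHS]mul1r -sg1 -normrM ler_norm.
have h1' : sg * v - sg * u <= b1 by apply: S; rewrite distrC.
have h3' := S _ _ _ h3; have h5' := S _ _ _ h5; lra.
Qed.

(** Two runs are chained: up to time [t], where the iterate is [f], and up to time [s], with the
    opposite sign. Their starting terms agree except on discarded starts, as [truncated_start]
    depends on the horizon only there. It remains to replace the position at time [s] by [0], at the
    price of contraction times first moment. *)
Lemma process_expectation_le (M eps sg e : R) (n : nat) :
  0 <= M -> `|sg| = 1 ->
  (M + t + a) * (K * 2^-1 ^+ n * expR (2 * (M + t + a) * t)) <= eps ->
  (\int[P]_w (bad_start M w)%:E <= e%:E)%E ->
  sg * (\int[P]_w f (X t w) - semigroup_iterate H a M t f n.+1 s 0) <=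
  2 * K * e + eps * t + 2 * K * e + eps * t + contraction * moment.
Proof.
move=> M0 sg1 le_eps bad_le.
pose phi := semigroup_iterate H a M t f n.+1.
have K0 : 0 <= K by exact: le_trans (f_bound 0).
have tt : 0 <= t <= t by rewrite t_ge0 lexx.
have st' : 0 <= s <= t by rewrite ltW.
have Nsg1 : `|- sg| = 1 by rewrite normrN.
have phiK r x : 0 <= r <= t -> `|phi r x| <= K.
  exact: (semigroup_iterate_norm Hsupp a_gt0 M0 t_ge0 f_lip f_bound).
have mphi := measurable_semigroup_iterate Hsupp a_gt0 M0 t_ge0 f_lip f_bound n.+1.
have mf : measurable_fun setT f.
  apply: continuous_measurable_fun.
  by apply: (@lipschitz_continuous _ _ 1) => x y; rewrite mul1r.
have mfX : measurable_fun setT (fun w => f (X t w)) by exact: measurableT_comp.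
have start_t s' w : 0 <= s' <= t -> 0 <= (truncated_start s' M (X 0 w)).1 <= t.
  by move=> s't; rewrite /truncated_start; case: ifP => _ //=; rewrite lexx t_ge0.
have mg1 s' : measurable_fun setT (fun w => phi s' (truncated_position X M s' w)).
  apply: (measurableT_comp mphi (g := fun w => (s', truncated_position X M s' w))).
  by apply: measurable_fun_pair => //; exact: measurable_truncated_position.
have mg2 s' : measurable_fun setT (fun w =>
    phi (truncated_start s' M (X 0 w)).1 (truncated_start s' M (X 0 w)).2).
  apply: (measurableT_comp mphi (g := fun w => truncated_start s' M (X 0 w))).
  by apply: measurableT_comp => //; exact: measurable_truncated_start.
have mKbad : measurable_fun setT (fun w => 2 * K * bad_start M w).
  by apply: measurable_funM; [exact: measurable_cst|exact: mbad].
have K2 : 0 <= 2 * K by rewrite mulr_ge0.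
have Kbad_ge0 w : 0 <= 2 * K * bad_start M w by exact: mulr_ge0.
have Kbad_le : (\int[P]_w (2 * K * bad_start M w)%:E <= (2 * K * e)%:E)%E.
  under eq_integral do rewrite EFinM.
  rewrite ge0_integralZl//.
  - by rewrite [leRHS]EFinM lee_wpmul2l// lee_fin.
  - by apply/measurable_EFinP; exact: mbad.
  - by move=> w _; rewrite lee_fin bad_ge0.
have bad_close (p q : R) w : `|p| <= K -> `|q| <= K ->
    ((0 <= X 0 w) && (X 0 w <= M) -> p = q) -> `|p - q| <= 2 * K * bad_start M w.
  move=> pK qK; rewrite /bad_start; case: ifP => _ => [->//|_]; first by rewrite subrr normr0 mulr0.
  rewrite mulr1 (le_trans (ler_normB _ _))// mulr_natl mulr2n; exact: lerD.
have i1 := iterate_expectation_le M0 sg1 le_eps tt.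
have i2 := iterate_expectation_le M0 Nsg1 le_eps st'.
apply: (signed_telescope_le sg1 _ i1 _ i2).
- apply: (Rintegral_close (mg1 t) (fun w => phiK _ _ tt) mfX (fun w => f_bound _)
    mKbad Kbad_ge0 _ Kbad_le).
  apply: aeW => w; apply: bad_close; [exact: phiK|exact: f_bound|].
  move=> good; rewrite /phi (semigroup_iterate_final H a M t_ge0).
  by rewrite /truncated_position good.
- apply: (Rintegral_close (mg2 t) (fun w => phiK _ _ (start_t _ w tt))
    (mg2 s) (fun w => phiK _ _ (start_t _ w st')) mKbad Kbad_ge0 _ Kbad_le).
  apply: aeW => w; apply: bad_close; [exact/phiK/start_t|exact/phiK/start_t|].
  by move=> good; rewrite /truncated_start good.
- rewrite -[X in _ - X](Rintegral_probability_cst P).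
  have mX : measurable_fun setT (fun w => contraction * `|X s w|).
    by apply: measurable_funM => //; exact: measurableT_comp.
  apply: (Rintegral_close (mg1 s) (fun w => phiK _ _ st') (measurable_cst _)
    (fun w => phiK s 0 st') mX).
  + by move=> w; rewrite mulr_ge0 ?expR_ge0.
  + apply: filterS (generated_ge0 X_gen (ltW s_gt0)) => w Xs.
    have Xt0 : 0 <= truncated_position X M s w by rewrite /truncated_position; case: ifP.
    apply: (le_trans (semigroup_iterate_contraction Hsupp a_gt0 M0 t_ge0 f_lip f_bound
      n.+1 st' Xt0 (lexx 0))).
    rewrite ler_wpM2l ?expR_ge0// subr0 ger0_norm// (le_trans _ (ler_norm _))//.
    by rewrite /truncated_position; case: ifP.
  + under eq_integral do rewrite EFinM.
    rewrite ge0_integralZl//.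
    * rewrite [leRHS]EFinM lee_wpmul2l ?lee_fin ?expR_ge0//.
      exact: (moment_bound Hsupp a_gt0 X_gen s_gt0).
    * by apply/measurable_EFinP; exact: measurableT_comp.
    * by rewrite lee_fin expR_ge0.
Qed.

End process_bound.

Lemma geometric_le (R : realType) (c z eps : R) : `|z| < 1 -> 0 < eps ->
  exists n, c * z ^+ n <= eps.
Proof.
move=> z1 eps0; have cvg0 := cvg_geometric c z1.
have [n _ le_eps] : \forall n \near \oo, geometric c z n < eps by exact: cvgr_lt cvg0 _ eps0.
by exists n; exact: ltW (le_eps n (leqnn n)).
Qed.

Section comparison.
Context (R : realType) (H : probability R R) (a : R) (d1 d2 : measure_display).
Variables (Omega1 : measurableType d1) (P1 : probability Omega1 R).
Variables (Omega2 : measurableType d2) (P2 : probability Omega2 R).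
Variables (X : R -> {RV P1 >-> R}) (Y : R -> {RV P2 >-> R}).
Hypotheses (Hsupp : H `[0, 1[%classic = 1%E) (a_gt0 : 0 < a).
Hypotheses (X_gen : generated_by_L a H X) (Y_gen : generated_by_L a H Y).
Variables (t s : R).
Hypotheses (s_gt0 : 0 < s) (st : s <= t).
Variables (f : R -> R) (K : R).
Hypothesis f_lip : forall x y, `|f x - f y| <= `|x - y|.
Hypothesis f_bound : forall x, `|f x| <= K.

Let rate := expR (- (a * kappa1 H * (t - s))) *
  (Num.sqrt (kappa1 H) * tanh (Num.sqrt (kappa1 H) * s))^-1.

Lemma sum_signed_le (A B p D e e0 eps : R) : 0 <= K -> 0 <= t -> 0 < e ->
  e0 = e / (16 * (K + 1)) -> eps = e / (8 * (t + 1)) ->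
  1 * (A - p) <= 2 * K * e0 + eps * t + 2 * K * e0 + eps * t + D ->
  - 1 * (B - p) <= 2 * K * e0 + eps * t + 2 * K * e0 + eps * t + D ->
  A <= B + 2 * D + e.
Proof.
move=> K0 t0 e_gt0 e0E epsE.
have K1 : K * e0 <= e / 16.
  have -> : e / 16 = (K + 1) * e0 by rewrite e0E; field; lra.
  by apply: ler_wpM2r; [rewrite e0E divr_ge0//; lra|lra].
have t1 : eps * t <= e / 8.
  have -> : e / 8 = eps * (t + 1) by rewrite epsE; field; lra.
  by apply: ler_wpM2l; [rewrite epsE divr_ge0//; lra|lra].
lra.
Qed.

Lemma Rintegral_process_le :
  \int[P1]_w f (X t w) <= \int[P2]_w f (Y t w) + 2 * rate.
Proof.
have K0 : 0 <= K by exact: le_trans (f_bound 0).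
have t0 : 0 <= t by exact: le_trans (ltW s_gt0) st.
apply/ler_addgt0Pr => e e_gt0.
(* Both processes together lose [8 * K * e0 + 4 * eps * t], at most [e / 2 + e / 2]; the added [1]
   keeps the denominators positive. *)
pose e0 := e / (16 * (K + 1)); pose eps := e / (8 * (t + 1)).
have e0_gt0 : 0 < e0 by rewrite divr_gt0// mulr_gt0//; lra.
have eps_gt0 : 0 < eps by rewrite divr_gt0// mulr_gt0//; lra.
have [M1 M1_ge0 tail1] := initial_tail X_gen e0_gt0.
have [M2 M2_ge0 tail2] := initial_tail Y_gen e0_gt0.
(* A common [M], then a common [n] depending on it, so that both expectations are compared with the
   same number, the iterate at time [s] and position [0]. *)
pose M := Num.max M1 M2.
have M_ge0 : 0 <= M by rewrite le_max M1_ge0.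
have bad1 := tail1 M; have bad2 := tail2 M.
rewrite le_max lexx in bad1; rewrite le_max lexx orbT in bad2.
have half1 : `|2^-1 : R| < 1 by rewrite ger0_norm; lra.
have [n le_eps] := geometric_le ((M + t + a) * K * expR (2 * (M + t + a) * t)) half1 eps_gt0.
have le_eps' : (M + t + a) * (K * 2^-1 ^+ n * expR (2 * (M + t + a) * t)) <= eps.
  by apply: le_trans le_eps; rewrite [K * _ * _]mulrAC !mulrA.
apply: (sum_signed_le K0 t0 e_gt0 erefl erefl).
  exact: (process_expectation_le Hsupp a_gt0 X_gen s_gt0 st f_lip f_bound
    M_ge0 (normr1 R) le_eps' (bad1 isT)).
have N1 : `|-1 : R| = 1 by rewrite normrN normr1.
exact: (process_expectation_le Hsupp a_gt0 Y_gen s_gt0 st f_lip f_bound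
    M_ge0 N1 le_eps' (bad2 isT)).
Qed.

End comparison.

Unset Implicit Arguments.
Set Strict Implicit.

Theorem theorem2p4 (R : realType) (H : probability R R) (a : R)
    (d1 d2 : measure_display)
    (Omega1 : measurableType d1) (P1 : probability Omega1 R)
    (Omega2 : measurableType d2) (P2 : probability Omega2 R)
    (X : R -> {RV P1 >-> R}) (Y : R -> {RV P2 >-> R})
    (Hsupp : H `[0, 1[%classic = 1%E) (a_gt0 : 0 < a)
    (X_gen : generated_by_L a H X) (Y_gen : generated_by_L a H Y) :
  let k1 := kappa1 H in
  let d := Num.sqrt k1 in
  forall t s : R, 0 < s < t ->
    (W1 (distribution P1 (X t)) (distribution P2 (Y t)) <=
     (2 * expR (a * k1 * s) / (d * tanh (d * s)) * expR (- (a * k1 * t)))%:E)%E.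
Proof.
move=> k d t s /andP[s0 st].
have t0 : 0 <= t by exact: ltW (lt_trans s0 st).
apply: (W1_le_lipschitz (generated_ge0 X_gen t0) (generated_ge0 Y_gen t0)).
move=> f K f_lip f_bound.
have fK x : `|f x| <= K by have /andP[f0 ?] := f_bound x; rewrite ger0_norm.
have mf : measurable_fun setT f.
  apply: continuous_measurable_fun.
  by apply: (@lipschitz_continuous _ _ 1) => x y; rewrite mul1r.
have mX : measurable_fun setT (fun w => f (X t w)) by exact: measurableT_comp.
have mY : measurable_fun setT (fun w => f (Y t w)) by exact: measurableT_comp.
rewrite (EFin_Rintegral_bounded P1 mX (fun w => fK _)).
rewrite (EFin_Rintegral_bounded P2 mY (fun w => fK _)) -EFinD lee_fin.
apply: le_trans (Rintegral_process_le Hsupp a_gt0 X_gen Y_gen s0 (ltW st) f_lip fK) _.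
rewrite lerD2l -/k -/d mulrBr opprB expRD.
by rewrite [leRHS]mulrAC !mulrA.
Qed.
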